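(* Let $t\in\mathbb{R}$, let $m,n\ge 0$ be integers, and let $w$ be a weight on $\mathbb{R}$ with $w\in C^d_{2t}\cap A^d_\infty$. Then the following hold for $f\in L^2(\mathbb{R})$. (i) If $0\le 2t<1$, there is $q>1$ such that $w\in A^d_q$; then $w^{2t}\in A^d_q$, and $$\|T^{m,n}_{t,w}f\|_2\le C_q(m+n+2)^3[w^{2t}]_{A^d_q}^{1/2}\|f\|_2\le C_q(m+n+2)^3[w]_{A^d_q}^{t}\|f\|_2.$$ (ii) If $2t\ge1$ and $w\in A^d_p$ (with $1<p<\infty$), then for $q=2t(p-1)+1$ one has $w^{2t}\in A^d_q$, and $$\|T^{m,n}_{t,w}f\|_2\le C_q(m+n+2)^3[w]_{C^d_{2t}}^{1/2}[w^{2t}]_{A^d_q}^{1/2}\|f\|_2\le C_p(m+n+2)^3[w]_{C^d_{2t}}[w]_{A^d_p}\|f\|_2.$$ (iii) If $t<0$, then for $q=1-2t$ one has $w^{2t}\in A^d_q$, and the bound becomes linear in the $C^d_{2t}$-characteristic of $w$: $$\|T^{m,n}_{t,w}f\|_2\le C(m+n+2)^3[w]_{C^d_{2t}}\|f\|_2.$$ Here $C_q>0$ and $C_p>0$ are constants depending only on the indicated parameter $q$, respectively $p$, and $C>0$ is a numerical constant.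
   Context: A weight is a locally integrable function on $\mathbb{R}$ that is positive almost everywhere. $|E|$ is Lebesgue measure, $m_Ig=\frac{1}{|I|}\int_I g(x)\,dx$, and $\|\cdot\|_2$ and $\langle\cdot,\cdot\rangle$ are the norm and inner product of $L^2(\mathbb{R})$. $\mathcal{D}$ is the collection of dyadic intervals $[k2^{-j},(k+1)2^{-j})$, $j,k\in\mathbb{Z}$. For $L\in\mathcal{D}$ and an integer $m\ge0$, $\mathcal{D}_m(L)$ is the set of dyadic intervals $I\subset L$ with $|I|=2^{-m}|L|$. For $I\in\mathcal{D}$ with right and left halves $I_+$, $I_-$, the Haar function is $h_I=|I|^{-1/2}(\chi_{I_+}-\chi_{I_-})$, where $\chi_E$ is the characteristic function of $E$. Dyadic Muckenhoupt classes: for $1<q<\infty$, a weight $v$ is in $A^d_q$ if $[v]_{A^d_q}:=\sup_{I\in\mathcal{D}}(m_Iv)\,(m_Iv^{-1/(q-1)})^{q-1}<\infty$; and $A^d_\infty:=\bigcup_{q>1}A^d_q$. $C^d_s$ class: for $s\in\mathbb{R}$, a weight $w$ is in $C^d_s$ if $[w]_{C^d_s}:=\sup_{I\in\mathcal{D}}(m_Iw^s)(m_Iw)^{-s}<\infty$. The $t$-Haar multiplier of complexity $(m,n)$ associated to $w$ is defined formally by $$T^{m,n}_{t,w}f(x)=\sum_{L\in\mathcal{D}}\ \sum_{I\in\mathcal{D}_m(L),\,J\in\mathcal{D}_n(L)}\frac{\sqrt{|I|\,|J|}}{|L|}\,\frac{w^t(x)}{(m_Lw)^t}\,\langle f,h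_I\rangle\,h_J(x).$$
   Formalization: In (ii) both norm bounds are proved for all 2t≥1, but the inequality between the middle and last expressions is stated only for t≤1, as it fails for t>1 (w=|x|^a, a→p−1). *)

(* Defs.v *)
From HB Require Import structures.
From mathcomp Require Export all_boot all_order all_algebra finmap.
From mathcomp Require Export all_classical all_reals all_analysis.
From mathcomp Require Export showcase.summability.

Set Implicit Arguments.
Unset Strict Implicit.
Unset Printing Implicit Defensive.

Import Order.TTheory GRing.Theory Num.Theory.
Import numFieldNormedType.Exports.

Local Open Scope classical_set_scope.
Local Open Scope ring_scope.

(* The pair (j, k) stands for the dyadic interval [k 2^-j, (k+1) 2^-j); the
   correspondence between pairs and intervals is bijective. *)
Notation dyadic := (int * int)%type.

Section tHaar.
Context {R : realType}.
Notation mu := (@lebesgue_measure R).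

Definition dlen (I : dyadic) : R := 2%:R ^ (- I.1).

Definition dset (I : dyadic) : set R :=
  `[I.2%:~R * dlen I, (I.2 + 1)%:~R * dlen I[.

Lemma dlen_gt0 (I : dyadic) : 0 < dlen I.
Proof. by rewrite exprz_gt0. Qed.

Lemma lebesgue_measure_dset (I : dyadic) : mu (dset I) = (dlen I)%:E.
Proof.
rewrite /dset lebesgue_measure_itv/= lte_fin intrD mulrDl mul1r ltrDl dlen_gt0.
by rewrite EFinN -EFinB addrAC subrr add0r.
Qed.

Definition dleft (I : dyadic) : dyadic := (I.1 + 1, 2 * I.2).
Definition dright (I : dyadic) : dyadic := (I.1 + 1, 2 * I.2 + 1).

Definition descendants (m : nat) (L : dyadic) : set dyadic :=
  [set I | dset I `<=` dset L /\ dlen I = 2%:R ^- m * dlen L].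

Definition haar (I : dyadic) (x : R) : R :=
  (Num.sqrt (dlen I))^-1 * (\1_(dset (dright I)) x - \1_(dset (dleft I)) x).

(* Extended-real valued, so that the average of a nonnegative function that is
   not integrable on I is +oo. *)
Definition mean (g : R -> R) (I : dyadic) : \bar R :=
  ((dlen I)^-1%:E * \int[mu]_(x in dset I) (g x)%:E)%E.

Definition weight (w : R -> R) : Prop :=
  locally_integrable [set: R] w /\ {ae mu, forall x, 0 < w x}.

Definition Ad_char (q : R) (v : R -> R) : \bar R :=
  ereal_sup [set (mean v I *
    mean (fun x => (v x `^ (- (q - 1)^-1))%R) I `^ (q - 1))%E | I in [set: dyadic]].

Definition in_Ad (q : R) (v : R -> R) : Prop :=
  weight v /\ (Ad_char q v < +oo)%E.

Definition in_Ad_infty (v : R -> R) : Prop := exists q, 1 < q /\ in_Ad q v.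

Definition Cd_char (s : R) (w : R -> R) : \bar R :=
  ereal_sup [set (mean (fun x => (w x `^ s)%R) I *
    mean w I `^ (- s))%E | I in [set: dyadic]].

Definition in_Cd (s : R) (w : R -> R) : Prop :=
  weight w /\ (Cd_char s w < +oo)%E.

Definition L2 (f : R -> R) : Prop := f \in Lfun mu 2%:E.

Definition L2norm (f : R -> R) : \bar R := Lnorm mu 2%:E (EFin \o f).

Definition L2dot (f g : R -> R) : R := \int[mu]_x (f x * g x).

Definition tHaar_term (t : R) (m n : nat) (w f : R -> R) (L : dyadic) (x : R)
    : R :=
  \sum_(I \in descendants m L) \sum_(J \in descendants n L)
    Num.sqrt (dlen I * dlen J) / dlen L *
    (w x `^ t / fine (mean w L) `^ t) * L2dot f (haar I) * haar J x.

(* The formal series defining the t-Haar multiplier is read as an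
   unconditionally convergent series in L^2, indexed by L: [tHaar t m n w f g]
   says that g is its sum, i.e. that g represents T^{m,n}_{t,w} f. Such a g is
   unique up to equality almost everywhere. *)
Definition tHaar (t : R) (m n : nat) (w f g : R -> R) : Prop :=
  L2 g /\
  L2norm (fun x => \sum_(L <- F) tHaar_term t m n w f L x - g x)
    @[F --> (@totally dyadic)] --> 0%E.

End tHaar.

(* Main.v *)
Require Import Defs.
From mathcomp Require Import ring lra zify measurable_realfun.

Set Implicit Arguments.
Unset Strict Implicit.
Unset Printing Implicit Defensive.

Import Order.TTheory GRing.Theory Num.Theory.
Import numFieldNormedType.Exports.

Local Open Scope classical_set_scope.
Local Open Scope ring_scope.

(** Put v = w^(2t), write v(J) for the integral of v over J and m_J for the
    average over J.  Since sqrt|J| h_J is 1 on the right half of J and -1 on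
    the left half, the sum r_{L,n} of these functions over J in D_n(L) takes
    only the values 1 and -1 on L, and the term of index L of the series is
      c_L (m_L w)^(-t) |L|^(-1/2) w^t r_{L,n},
    where c_L = |L|^(-1/2) times the sum of sqrt|I| <f, h_I> over I in D_m(L).

    Two square-function estimates carry the theorem.  The coefficients satisfy
    sum c_L^2 <= (m + 1) ||f||^2 [haar_coefficients_bound].  The functions that
    they multiply satisfy || sum a_L w^t r_{L,n} / v(L)^(1/2) ||^2 <=
    K sum a_L^2 [square_integral_rademacher_le], and the definition of C^d_{2t}
    lets (m_L w)^(-2t) |L|^(-1) be replaced by a multiple of 1 / v(L).  By
    duality the second estimate amounts to
      sum_L (integral over L of G v r_{L,n})^2 / v(L)
        <= (2 (n + 1) + 8 B) (integral of G^2 v)       [dual_inequality].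
    Subtract from G its v-average on L.  Of the remainder, r_{L,n} sees only
    n + 1 martingale differences with respect to v, which are orthogonal
    [oscillation_bound].  The averages are handled by the Carleson embedding
    theorem for the measure v [carleson_embedding], for which one needs the
    packing condition
      sum over J inside I of (v(J_+) - v(J_-))^2 / v(J) <= B v(I).

    The packing condition follows from a Bellman function argument [buckley]
    as soon as the averages of v are comparable, up to a factor Q, with a
    sequence z_J growing convexly enough along the tree; then B = 136 Q.  Two
    sequences are used.  The geometric means z_J = exp(m_J ln v) are admissible
    with Q = [v]_{A^d_q} for every q > 1, by Jensen's inequality
    [carleson_Ad]; as 136 does not depend on q, neither do the constants in the
    theorem.  The powers z_J = (m_J w)^(2t) are admissible with
    Q = [w]_{C^d_{2t}} when 2t >= 2 [carleson_Cd]; this gives the last bound of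
    part (ii) for t > 1, where [w]_{A^d_p}^t can exceed [w]_{A^d_p}.

    The remaining inequalities between characteristics are instances of
    Jensen's inequality.  Finally, the two square-function estimates show that
    the partial sums of the series over finite sets of intervals form a Cauchy
    net, so that the series converges by completeness of L^2
    [unconditional_sum]. *)

(** * Elementary inequalities *)

Section ElementaryInequalities.
Context {R : realType}.
Implicit Types (a b c s x y z u : R).

Lemma le_of_sqr_le x y : 0 <= y -> x ^+ 2 <= y ^+ 2 -> x <= y.
Proof.
move=> y0 h; have [x0|x0] := leP 0 x; last exact: le_trans (ltW x0) y0.
by rewrite -(ler_pXn2r (n := 2)) ?nnegrE.
Qed.

(** This is ln y >= 1 - 1/y at y = sqrt u.  Unlike the tangent line of u ln u at
    1, the bound keeps a quadratic gain when averaged over u = 1 + a and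
    u = 1 - a. *)
Lemma mul_ln_ge_sqrt u : 0 < u -> 2 * (u - Num.sqrt u) <= u * ln u.
Proof.
move=> u0; have s0 : 0 < Num.sqrt u by rewrite sqrtr_gt0.
rewrite -{1 3 4}(sqr_sqrtr (ltW u0)) lnXn//.
have := le_ln1Dx (x := (Num.sqrt u)^-1 - 1).
rewrite ltrBrDl subrr invr_gt0 => /(_ s0).
rewrite addrC subrK lnV ?posrE// => h.
have {}h : 1 - (Num.sqrt u)^-1 <= ln (Num.sqrt u) by lra.
have := ler_wpM2l (ltW (exprn_gt0 2 s0)) h.
rewrite mulrBr mulr1 {2}expr2 mulfK ?gt_eqF// mulr2n => {}h.
set r := _ ^+ 2 in h *; set l := ln _ in h *; lra.
Qed.

Lemma sqrt_midpoint_le a : -1 < a < 1 ->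
  Num.sqrt (1 + a) + Num.sqrt (1 - a) <= 2 - a ^+ 2 / 4.
Proof.
move=> /andP[a1 a2].
have p0 : 0 <= 1 + a by lra.
have m0 : 0 <= 1 - a by lra.
set p := Num.sqrt (1 + a); set m := Num.sqrt (1 - a).
have pE : p ^+ 2 = 1 + a by rewrite sqr_sqrtr.
have mE : m ^+ 2 = 1 - a by rewrite sqr_sqrtr.
have pm : p * m <= 1 - a ^+ 2 / 2.
  apply: le_of_sqr_le; first by nra.
  rewrite exprMn pE mE; have := sqr_ge0 (a ^+ 2); nra.
apply: le_of_sqr_le; first by nra.
have -> : (p + m) ^+ 2 = p ^+ 2 + m ^+ 2 + 2 * (p * m) by ring.
have := sqr_ge0 (a ^+ 2); rewrite pE mE; nra.
Qed.

(** Quantitative convexity of x ln x, whose second derivative is 1/x.  By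
    homogeneity only the pair 1 + a, 1 - a matters. *)
Lemma entropy_midpoint x y : 0 < x -> 0 < y ->
  (x + y) * ln ((x + y) / 2) + (x - y) ^+ 2 / (4 * (x + y)) <=
  x * ln x + y * ln y.
Proof.
move=> x0 y0; set M := (x + y) / 2; set a := (x - y) / (x + y).
have xy0 : 0 < x + y by lra.
have M0 : 0 < M by rewrite /M; lra.
have hx : x = M * (1 + a) by rewrite /M /a; field; lra.
have hy : y = M * (1 - a) by rewrite /M /a; field; lra.
have a1 : -1 < a < 1.
  by rewrite /a ltr_pdivrMr// ltr_pdivlMr//; apply/andP; split; lra.
have [p0 m0] : 0 < 1 + a /\ 0 < 1 - a by move/andP: a1; lra.
have -> : (x - y) ^+ 2 / (4 * (x + y)) = M * (a ^+ 2 / 2).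
  by rewrite /M /a; field; lra.
have -> : x + y = 2 * M by rewrite /M; field.
rewrite {1 2}hx {1 2}hy !lnM ?posrE//.
have h1 := mul_ln_ge_sqrt p0; have h2 := mul_ln_ge_sqrt m0.
have h3 := sqrt_midpoint_le a1.
have : 0 <= M * ((1 + a) * ln (1 + a) + (1 - a) * ln (1 - a) - a ^+ 2 / 2).
  apply: mulr_ge0; first exact: ltW.
  move: h1 h2 h3; set p := Num.sqrt _; set m := Num.sqrt _.
  set lp := _ * ln _; set lm := _ * ln _; lra.
rewrite !mulrBr !mulrDr; set lM := ln M; set lp := ln _; set lm := ln _; lra.
Qed.

(** The excess of the average over 1 is (e^(b/2) - e^(-b/2))^2 / 2. *)
Lemma cosh_ge b : 1 + b ^+ 2 / 8 <= (expR b + expR (- b)) / 2.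
Proof.
wlog b0 : b / 0 <= b.
  move=> H; have [|b0] := leP 0 b; first exact: H.
  have /H : 0 <= - b by lra.
  by rewrite opprK sqrrN [expR (- b) + _]addrC.
set e := expR (b / 2).
have eE : expR b = e ^+ 2 by rewrite -expRM_natl; congr expR; field.
have eNE : expR (- b) = (e^-1) ^+ 2.
  by rewrite -expRN -expRM_natl; congr expR; field.
have e1 : 1 + b / 2 <= e by exact: expR_ge1Dx.
have e0 : 0 < e by exact: expR_gt0.
have ee : e * e^-1 = 1 by rewrite divff// gt_eqF.
have f1 : e^-1 <= 1 by rewrite invf_le1//; lra.
rewrite eE eNE; set f := e^-1 in ee f1 *.
have : (b / 2) ^+ 2 <= (e - f) ^+ 2 by rewrite ler_sqr ?nnegrE; lra.
have -> : (e - f) ^+ 2 = e ^+ 2 + f ^+ 2 - 2 * (e * f) by ring.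
rewrite ee; lra.
Qed.

Lemma ln_le_sub1 u : 0 < u -> ln u <= u - 1.
Proof.
move=> u0; have := le_ln1Dx (x := u - 1).
by rewrite ltrBrDl subrr addrC subrK => /(_ u0).
Qed.

(** The geometric mean of u and 1 with weights s and 1 - s is at most the
    arithmetic mean. *)
Lemma powR_le_tangent s u : 0 < u -> 0 <= s <= 1 -> u `^ s <= 1 + s * (u - 1).
Proof.
move=> u0 /andP[s0 s1].
have p0 : 0 < 1 + s * (u - 1) by nra.
rewrite -ler_ln ?posrE ?powR_gt0// ln_powR.
have [->|sn0] := eqVneq s 0; first by rewrite !mul0r addr0 ln1.
set A := 1 + s * (u - 1) in p0 *.
(* tangent lines to the logarithm at the convex combination A *)
have h1 : ln u - ln A <= u / A - 1.
  by rewrite -ln_div ?posrE//; apply/ln_le_sub1/divr_gt0.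
have h2 : - ln A <= A^-1 - 1 by rewrite -lnV ?posrE//; apply/ln_le_sub1; rewrite invr_gt0.
have h1' := ler_wpM2l s0 h1.
have s1' : 0 <= 1 - s by lra.
have h2' := ler_wpM2l s1' h2.
have E : s * (u / A - 1) + (1 - s) * (A^-1 - 1) = 0.
  rewrite /A; field; exact: lt0r_neq0.
move: (lerD h1' h2'); rewrite E; set lu := ln u; set lA := ln A; nra.
Qed.

(** The previous inequality for u^s and the exponent 1/s. *)
Lemma powR_ge_tangent s u : 0 < u -> 1 <= s -> 1 + s * (u - 1) <= u `^ s.
Proof.
move=> u0 s1; have s0 : 0 < s by lra.
have us : 0 < u `^ s by exact: powR_gt0.
have si : 0 <= s^-1 <= 1 by rewrite invr_ge0 (ltW s0) invf_le1//= s1.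
have := powR_le_tangent us si.
rewrite -powRrM divff ?gt_eqF// (powRr1 (ltW u0)).
move=> /(ler_wpM2l (ltW s0)); rewrite mulrDr mulr1 mulrA divff ?gt_eqF// mul1r.
lra.
Qed.

(** The gain is quadratic in s c, not merely linear in s: this keeps the packing
    constant of [carleson_Cd] bounded as s grows. *)
Lemma powR_midpoint s c : 2 <= s -> -1 < c < 1 ->
  1 + (s * c) ^+ 2 / 8 <= ((1 + c) `^ s + (1 - c) `^ s) / 2.
Proof.
move=> s2; wlog c0 : c / 0 <= c.
  move=> H /andP[c1 c2]; have [|c0] := leP 0 c.
    by move=> /H; apply; rewrite c1 c2.
  have /H : 0 <= - c by lra.
  rewrite opprK mulrN sqrrN [_ `^ s + _]addrC; apply.
  by apply/andP; split; lra.
move=> /andP[_ c1].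
have p0 : 0 < 1 + c by lra.
have m0 : 0 < 1 - c by lra.
have h2 : forall u, 0 < u -> u `^ s = (u `^ (s / 2)) ^+ 2.
  by move=> u u0; rewrite -powR_mulrn ?powR_ge0// -powRrM divfK// pnatr_eq0.
have s1 : 1 <= s / 2 by lra.
have hp := powR_ge_tangent p0 s1; have hm := powR_ge_tangent m0 s1.
have s1' : 1 <= s by lra.
have hm' := powR_ge_tangent m0 s1'.
have P : (1 + s / 2 * c) ^+ 2 <= (1 + c) `^ s.
  by rewrite (h2 _ p0) ler_sqr ?nnegrE ?powR_ge0//; nra.
(* Square the tangent line of the power s / 2; where it is negative on the
   left, the Bernoulli bound for the power s is enough. *)
have [sc|sc] := leP (s / 2 * c) 1.
  have M : (1 - s / 2 * c) ^+ 2 <= (1 - c) `^ s.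
    by rewrite (h2 _ m0) ler_sqr ?nnegrE ?powR_ge0//; nra.
  nra.
nra.
Qed.

End ElementaryInequalities.

(** * Sums over the dyadic tree *)

Section TreeSums.
Context {R : realType}.
Implicit Types (F G A v q : dyadic -> R) (I J L : dyadic).

Fixpoint levelsum F I (k : nat) : R :=
  if k is k'.+1 then levelsum F (dleft I) k' + levelsum F (dright I) k'
  else F I.

Definition treesum F I (N : nat) : R := \sum_(k < N) levelsum F I k.

Definition dyadic_additive A := forall J, A J = A (dleft J) + A (dright J).

Lemma levelsum_additive A I k : dyadic_additive A -> levelsum A I k = A I.
Proof. by move=> hA; elim: k I => //= k IH I; rewrite !IH -hA. Qed.

Lemma levelsum_le F G I k : (forall J, F J <= G J) ->
  levelsum F I k <= levelsum G I k.
Proof. by move=> h; elim: k I => //= k IH I; rewrite lerD. Qed.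

Lemma eq_levelsum F G I k : F =1 G -> levelsum F I k = levelsum G I k.
Proof. by move=> h; elim: k I => //= k IH I; rewrite !IH. Qed.

Lemma levelsum_ge0 F I k : (forall J, 0 <= F J) -> 0 <= levelsum F I k.
Proof. by move=> h; elim: k I => //= k IH I; rewrite addr_ge0. Qed.

Lemma levelsumD F G I k :
  levelsum (fun J => F J + G J) I k = levelsum F I k + levelsum G I k.
Proof. by elim: k I => //= k IH I; rewrite !IH addrACA. Qed.

Lemma levelsumZ c F I k : levelsum (fun J => c * F J) I k = c * levelsum F I k.
Proof. by elim: k I => //= k IH I; rewrite !IH mulrDr. Qed.

Lemma levelsum_levelsum F I k n :
  levelsum (fun J => levelsum F J n) I k = levelsum F I (k + n).
Proof. by elim: k I => //= k IH I; rewrite !IH. Qed.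

Lemma levelsum_recr F I k :
  levelsum F I k.+1 = levelsum (fun J => F (dleft J) + F (dright J)) I k.
Proof. by rewrite -addn1 -levelsum_levelsum; exact: eq_levelsum. Qed.

Lemma treesum0 F I : treesum F I 0 = 0.
Proof. by rewrite /treesum big_ord0. Qed.

Lemma treesumS F I N :
  treesum F I N.+1 = F I + (treesum F (dleft I) N + treesum F (dright I) N).
Proof. by rewrite /treesum big_ord_recl /= -big_split. Qed.

Lemma treesum_le F G I N : (forall J, F J <= G J) ->
  treesum F I N <= treesum G I N.
Proof. by move=> h; apply: ler_sum => k _; exact: levelsum_le. Qed.

Lemma treesum_ge0 F I N : (forall J, 0 <= F J) -> 0 <= treesum F I N.
Proof. by move=> h; apply: sumr_ge0 => k _; exact: levelsum_ge0. Qed.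

Lemma treesumD F G I N :
  treesum (fun J => F J + G J) I N = treesum F I N + treesum G I N.
Proof. by rewrite -big_split; apply: eq_bigr => k _; exact: levelsumD. Qed.

Lemma treesumZ c F I N : treesum (fun J => c * F J) I N = c * treesum F I N.
Proof. by rewrite mulr_sumr; apply: eq_bigr => k _; exact: levelsumZ. Qed.

Lemma treesum_levelsum_le F I N n : (forall J, 0 <= F J) ->
  treesum (fun J => levelsum F J n) I N <= treesum F I (n + N).
Proof.
move=> F0; rewrite [leRHS]/treesum big_split_ord /=.
rewrite (eq_bigr (fun k : 'I_N => levelsum (fun J => levelsum F J n) I k)).
  by rewrite lerDr; apply: sumr_ge0 => k _; exact: levelsum_ge0.
by move=> k _; rewrite levelsum_levelsum addnC.
Qed.

Lemma treesum_telescope F G I N :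
  (forall J, F J <= G (dleft J) + G (dright J) - G J) ->
  treesum F I N <= levelsum G I N - G I.
Proof.
move=> h; elim: N I => [|N IH] I; first by rewrite treesum0 subrr.
have := h I; have := IH (dleft I); have := IH (dright I).
rewrite treesumS /=; lra.
Qed.

Lemma cauchy_schwarz_pair (a a' v v' q q' : R) :
  0 <= v -> 0 <= v' -> 0 <= q -> 0 <= q' ->
  a ^+ 2 <= v * q -> a' ^+ 2 <= v' * q' ->
  (a + a') ^+ 2 <= (v + v') * (q + q').
Proof.
move=> v0 v'0 q0 q'0 h h'.
have h2 : (a * a') ^+ 2 <= (v * q') * (v' * q).
  rewrite (_ : v * q' * (v' * q) = v * q * (v' * q')); last by ring.
  by rewrite exprMn; apply: ler_pM => //; exact: sqr_ge0.
have h3 : 2 * (a * a') <= v * q' + v' * q.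
  apply: le_of_sqr_le; first by nra.
  have := sqr_ge0 (v * q' - v' * q); nra.
nra.
Qed.

Lemma levelsum_cauchy_schwarz F v q L n :
  (forall J, 0 <= v J) -> (forall J, 0 <= q J) ->
  (forall J, F J ^+ 2 <= v J * q J) ->
  levelsum F L n ^+ 2 <= levelsum v L n * levelsum q L n.
Proof.
move=> v0 q0 h; elim: n L => //= n IH L.
by apply: cauchy_schwarz_pair => //; exact: levelsum_ge0.
Qed.

End TreeSums.

(** * The dual inequality on the tree *)

Section DualInequality.
Context {R : realType}.
Implicit Types (A v q x z b lam : dyadic -> R) (I J L : dyadic).

Definition jump A J : R := A (dright J) - A (dleft J).

(** A shift by n + 1 is a composition of n + 1 unit shifts, and for each of these
    the sum telescopes. *)
Lemma sum_shift_le (a : nat -> R) (B : R) (N n : nat) :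
  (forall k, 0 <= a k <= B) ->
  \sum_(k < N) (a (k + n.+1)%N - a k) <= n.+1%:R * B.
Proof.
move=> h; have step i : \sum_(k < N) (a (k + i).+1 - a (k + i)%N) <= B.
  rewrite (eq_bigr (fun k : 'I_N => (fun k => a (k + i)%N) k.+1 -
    (fun k => a (k + i)%N) k)) //.
  rewrite -(big_mkord xpredT (fun k => a (k.+1 + i)%N - a (k + i)%N)).
  rewrite (telescope_sumr (fun k => a (k + i)%N))//.
  have /andP[_ h1] := h (N + i)%N; have /andP[h2 _] := h (0 + i)%N; lra.
elim: n => [|n IH].
  rewrite mul1r; apply: le_trans (step 0%N).
  by apply: ler_sum => k _; rewrite addn0 addn1.
rewrite -natr1 mulrDl mul1r; apply: le_trans (lerD IH (step n.+1)).
by rewrite -big_split; apply: ler_sum => k _ /=; rewrite addnS; lra.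
Qed.

(** If A and v are the integrals of G v and v, then A L / v L is the v-average of
    G over L, and the left-hand side tests G minus this average against a
    function of modulus 1.  By Cauchy-Schwarz the term of index L is at most the
    increase of A^2 / v between L and its descendants of generation n + 1; the
    level sums of A^2 / v are bounded by q. *)
Lemma oscillation_bound A v q I N n :
  dyadic_additive A -> dyadic_additive v -> dyadic_additive q -> (forall J, 0 < v J) ->
  (forall J, A J ^+ 2 <= v J * q J) ->
  treesum (fun L => (levelsum (jump A) L n - A L / v L * levelsum (jump v) L n)
             ^+ 2 / v L) I N <= n.+1%:R * q I.
Proof.
move=> hA hv hq v0 hAq.
pose Q J := A J ^+ 2 / v J.
have Q0 J : 0 <= Q J by rewrite /Q divr_ge0 ?sqr_ge0 ?ltW.
have Qq J : Q J <= q J by rewrite /Q ler_pdivrMr// mulrC.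
have lev k J : 0 <= levelsum Q J k <= q J.
  rewrite levelsum_ge0//= -(levelsum_additive J k hq).
  exact: levelsum_le.
have key L : (levelsum (jump A) L n - A L / v L * levelsum (jump v) L n) ^+ 2 /
    v L <= levelsum Q L n.+1 - Q L.
  set e := A L / v L.
  pose r J := (A J - e * v J) ^+ 2 / v J.
  have r0 J : 0 <= r J by rewrite /r divr_ge0 ?sqr_ge0 ?ltW.
  have rE J : r J = (-2 * e) * A J + (e ^+ 2 * v J + Q J).
    by rewrite /r /Q; field; exact: lt0r_neq0.
  have -> : levelsum Q L n.+1 - Q L = levelsum r L n.+1.
    rewrite (eq_levelsum _ _ rE) levelsumD levelsumZ levelsumD levelsumZ.
    rewrite (levelsum_additive L n.+1 hA) (levelsum_additive L n.+1 hv).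
    by rewrite /Q /e; field; exact: lt0r_neq0.
  rewrite ler_pdivrMr// [leRHS]mulrC -(levelsum_additive L n hv).
  have -> : levelsum (jump A) L n - e * levelsum (jump v) L n =
      levelsum (fun J => jump A J + (- e) * jump v J) L n.
    by rewrite levelsumD levelsumZ mulNr.
  rewrite levelsum_recr; apply: levelsum_cauchy_schwarz => J.
  - exact: ltW.
  - exact: addr_ge0.
  - rewrite hv (_ : jump A J + - e * jump v J =
      - (A (dleft J) - e * v (dleft J)) + (A (dright J) - e * v (dright J))).
      have rv K : (A K - e * v K) ^+ 2 = v K * r K.
        by rewrite /r [RHS]mulrC divfK// gt_eqF.
      by apply: cauchy_schwarz_pair; rewrite ?sqrrN ?rv ?r0// ltW.
    by rewrite /jump; ring.
apply: le_trans (treesum_le _ _ key) _.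
rewrite /treesum (eq_bigr (fun k : 'I_N =>
  levelsum Q I (k + n.+1) - levelsum Q I k)).
  by apply: (sum_shift_le (a := levelsum Q I)) => k.
move=> k _.
rewrite (eq_levelsum _ _ (G := fun J => levelsum Q J n.+1 + (-1) * Q J)).
  by rewrite levelsumD levelsumZ mulN1r levelsum_levelsum.
by move=> J; rewrite mulN1r.
Qed.

(** The Bellman function is 4 (q - A^2 / (v + M)), with M the Carleson mass below
    the interval divided by C, so that M <= v.  The function A^2 / (v + M) is
    convex and homogeneous, hence subadditive over the two halves; the mass mu at
    the interval itself lowers it by at least A^2 mu / (2 v)^2. *)
Lemma carleson_embedding A v q lam (C : R) I N :
  0 < C -> dyadic_additive A -> dyadic_additive v -> dyadic_additive q -> (forall J, 0 < v J) ->
  (forall J, A J ^+ 2 <= v J * q J) -> (forall J, 0 <= lam J) ->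
  (forall J M, treesum lam J M <= C * v J) ->
  treesum (fun L => (A L / v L) ^+ 2 * lam L) I N <= 4 * C * q I.
Proof.
move=> C0 hA hv hq v0 hAq lam0 hlam.
have q0 J : 0 <= q J.
  by rewrite -(pmulr_rge0 _ (v0 J)); apply: le_trans (hAq J); exact: sqr_ge0.
pose M k J := treesum lam J k / C.
have M0 k J : 0 <= M k J by rewrite divr_ge0 ?treesum_ge0// ltW.
have Mv k J : M k J <= v J by rewrite ler_pdivrMr// mulrC.
suff : treesum (fun L => (A L / v L) ^+ 2 * lam L) I N <=
    4 * C * (q I - A I ^+ 2 / (v I + M N I)).
  move=> /le_trans; apply; rewrite ler_pM2l ?mulr_gt0// gerBl divr_ge0 ?sqr_ge0//.
  by rewrite addr_ge0// ltW.
elim: N I => [|N IH] I.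
  rewrite treesum0 /M treesum0 mul0r addr0 mulr_ge0//; first by rewrite mulr_ge0// ltW.
  by rewrite subr_ge0 ler_pdivrMr// mulrC.
rewrite treesumS; have := IH (dleft I); have := IH (dright I).
set Tl := treesum _ (dleft I) N; set Tr := treesum _ (dright I) N => hr hl.
set P := v (dleft I) + M N (dleft I); set S := v (dright I) + M N (dright I).
have P0 : 0 < P by rewrite ltr_wpDr.
have S0 : 0 < S by rewrite ltr_wpDr.
have T0 : 0 < P + S by rewrite addr_gt0.
have MS : v I + M N.+1 I = P + S + lam I / C.
  rewrite /M treesumS hv /P /S /M; field; exact: lt0r_neq0.
have PSv : P + S + lam I / C <= 2 * v I.
  by rewrite -MS mulr2n mulrDl mul1r lerD2l.
have l0 : 0 <= lam I / C by rewrite divr_ge0// ltW.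
have vPS : v I <= P + S by rewrite hv lerD// lerDl.
have conv : A I ^+ 2 / (P + S) <= A (dleft I) ^+ 2 / P + A (dright I) ^+ 2 / S.
  rewrite ler_pdivrMr// [leRHS]mulrC hA.
  apply: cauchy_schwarz_pair; try (exact: ltW); try (by rewrite divr_ge0 ?sqr_ge0// ltW).
  - by rewrite [leRHS]mulrC divfK// gt_eqF.
  - by rewrite [leRHS]mulrC divfK// gt_eqF.
have drop : A I ^+ 2 / (P + S + lam I / C) + (A I / v I) ^+ 2 * lam I / (4 * C)
    <= A I ^+ 2 / (P + S).
  have U0 : 0 < P + S + lam I / C by rewrite ltr_wpDr.
  rewrite -subr_ge0.
  have -> : A I ^+ 2 / (P + S) - (A I ^+ 2 / (P + S + lam I / C) +
      (A I / v I) ^+ 2 * lam I / (4 * C)) =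
    A I ^+ 2 * (lam I / C) *
      (((P + S) * (P + S + lam I / C))^-1 - (4 * v I ^+ 2)^-1).
    field; repeat (apply/andP; split); try exact: lt0r_neq0.
    rewrite -[X in X != _]/((P + S) * C + lam I).
    by rewrite gt_eqF// ltr_wpDr// mulr_gt0.
  apply: mulr_ge0; first by rewrite mulr_ge0 ?sqr_ge0.
  rewrite subr_ge0 lef_pV2 ?posrE ?mulr_gt0 ?exprn_gt0//.
  have := v0 I; nra.
have C4 : 0 <= 4 * C by lra.
rewrite MS; have := ler_wpM2l C4 drop; have := ler_wpM2l C4 conv.
rewrite [4 * C * (_ + _ * lam I / _)]mulrDr [X in _ + X <= _]mulrC divfK; last first.
  by rewrite mulf_neq0// gt_eqF.
move: hr hl; rewrite -/P -/S (hq I).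
move: (A _ ^+ 2 / P) (A _ ^+ 2 / S) (A _ ^+ 2 / (P + S)).
move: (A _ ^+ 2 / _) ((A I / v I) ^+ 2 * lam I) => a1 a2 a3 a4 a5; lra.
Qed.

(** Split G into its oscillation around its v-average on L and that average.  The
    weights of the averages inherit the packing condition from the single jumps,
    because an interval is a descendant of generation n of at most one L. *)
Lemma dual_inequality A v q (B : R) I N n :
  0 < B -> dyadic_additive A -> dyadic_additive v -> dyadic_additive q -> (forall J, 0 < v J) ->
  (forall J, A J ^+ 2 <= v J * q J) ->
  (forall J M, treesum (fun K => jump v K ^+ 2 / v K) J M <= B * v J) ->
  treesum (fun L => levelsum (jump A) L n ^+ 2 / v L) I N <=
    (2 * n.+1%:R + 8 * B) * q I.
Proof.
move=> B0 hA hv hq v0 hAq hB.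
pose lam L := levelsum (jump v) L n ^+ 2 / v L.
have jv0 K : 0 <= jump v K ^+ 2 / v K by rewrite divr_ge0 ?sqr_ge0 ?ltW.
have lam0 J : 0 <= lam J by rewrite divr_ge0 ?sqr_ge0 ?ltW.
have lamB J M : treesum lam J M <= B * v J.
  apply: le_trans (hB J (n + M)%N).
  apply: le_trans (treesum_levelsum_le J M n jv0); apply: treesum_le => L.
  rewrite /lam ler_pdivrMr// [leRHS]mulrC -{1}(levelsum_additive L n hv).
  apply: levelsum_cauchy_schwarz => // K; first exact: ltW.
  by rewrite [leRHS]mulrC divfK// gt_eqF.
have h1 := oscillation_bound I N n hA hv hq v0 hAq.
have h2 := carleson_embedding I N B0 hA hv hq v0 hAq lam0 lamB.
apply: (@le_trans _ _ (2 * (n.+1%:R * q I) + 2 * (4 * B * q I))); last by lra.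
apply: le_trans (lerD (ler_wpM2l (ler0n R 2) h1) (ler_wpM2l (ler0n R 2) h2)).
rewrite -!treesumZ -treesumD; apply: treesum_le => L.
set X := levelsum (jump A) L n; rewrite /lam.
set Y := levelsum (jump v) L n; move: (A L / v L) => e.
rewrite [e ^+ 2 * _]mulrA -exprMn !mulrA -mulrDl ler_pM2r ?invr_gt0//.
have := sqr_ge0 (X - 2 * (e * Y)); nra.
Qed.

(** The Bellman function is E = x ln x - x ln z + 16 Q z, which lies between 0 and
    17 Q x.  Passing from an interval to its halves, with d the difference of the
    two values of x, the first term gains d^2 / (16 x), the second loses at most
    d b / 2, and the third gains 2 x b^2 because Q z >= x; the two gains absorb
    the loss and leave d^2 / (32 x).  Only values at an interval and at its
    halves are compared, so it does not matter that the domain z <= x <= Q z is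
    not convex in the variables (x, ln z). *)
Lemma buckley x z b (Q : R) I N :
  1 <= Q -> (forall J, x J = (x (dleft J) + x (dright J)) / 2) ->
  (forall J, 0 < z J <= x J) -> (forall J, x J <= Q * z J) ->
  (forall J, ln (z (dright J)) <= ln (z J) + b J) ->
  (forall J, ln (z (dleft J)) <= ln (z J) - b J) ->
  (forall J, z J * (1 + b J ^+ 2 / 8) <= (z (dleft J) + z (dright J)) / 2) ->
  treesum (fun J => dlen J * (jump x J ^+ 2 / (4 * x J))) I N <=
    136 * Q * (dlen I * x I).
Proof.
move=> Q1 xm zx xQ lr ll zm.
have z0 J : 0 < z J by case/andP: (zx J).
have zlex J : z J <= x J by case/andP: (zx J).
have x0 J : 0 < x J by exact: lt_le_trans (zlex J).
have dlS (J : dyadic) : dlen (dleft J) = dlen J / 2 :> R.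
  by rewrite /dlen /= opprD expfzDr ?pnatr_eq0.
have drS (J : dyadic) : dlen (dright J) = dlen J / 2 :> R by rewrite -dlS.
pose E J := x J * (ln (x J) - ln (z J)) + 16 * Q * z J.
pose G J := dlen J * E J.
have lnx J : 0 <= ln (x J) - ln (z J) <= Q.
  rewrite subr_ge0 ler_ln ?posrE// zlex /= -ln_div ?posrE//.
  apply: le_trans (ltW (ln_sublinear _)) _; first exact: divr_gt0.
  by rewrite ler_pdivrMr.
have E0 J : 0 <= E J.
  have /andP[h _] := lnx J; rewrite /E addr_ge0 ?mulr_ge0// ?ltW//; lra.
have EQ J : E J <= 17 * Q * x J.
  have /andP[_ h] := lnx J; have := zlex J; have := x0 J.
  have := ler_wpM2l (ltW (x0 J)) h; rewrite /E; nra.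
have step J : dlen J * (jump x J ^+ 2 / (32 * x J)) <=
    G (dleft J) + G (dright J) - G J.
  rewrite /G dlS drS.
  have -> : dlen J / 2 * E (dleft J) + dlen J / 2 * E (dright J) - dlen J * E J
     = dlen J * ((E (dleft J) + E (dright J)) / 2 - E J) by field.
  rewrite ler_pM2l ?dlen_gt0//.
  have h1 := entropy_midpoint (x0 (dleft J)) (x0 (dright J)).
  have h2 := zm J; have hx := xm J.
  have hr := ler_wpM2l (ltW (x0 (dright J))) (lr J).
  have hl := ler_wpM2l (ltW (x0 (dleft J))) (ll J).
  have x2 : x (dleft J) + x (dright J) = 2 * x J by rewrite hx; field.
  rewrite -hx x2 in h1.
  rewrite /jump in h1 *.
  have ->: (x (dright J) - x (dleft J)) ^+ 2 / (32 * x J) =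
      (x (dright J) - x (dleft J)) ^+ 2 / x J / 32 by field; exact: lt0r_neq0.
  have h1' : 2 * x J * ln (x J) + (x (dright J) - x (dleft J)) ^+ 2 / x J / 8 <=
      x (dleft J) * ln (x (dleft J)) + x (dright J) * ln (x (dright J)).
    move: h1; congr (_ + _ <= _); field; exact: lt0r_neq0.
  have Q16 : 0 <= 16 * Q by lra.
  have hQ := ler_wpM2l Q16 h2.
  have xb : 2 * x J * b J ^+ 2 <= 16 * Q * (z J * (b J ^+ 2 / 8)).
    have := ler_wpM2r (sqr_ge0 (b J)) (xQ J); lra.
  set d := x (dright J) - x (dleft J) in h1' *.
  have sq : d * b J <= d ^+ 2 / x J / 16 + 4 * x J * b J ^+ 2.
    have -> : d ^+ 2 / x J / 16 + 4 * x J * b J ^+ 2 =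
      (d / 4 - 2 * x J * b J) ^+ 2 / x J + d * b J.
      field; exact: lt0r_neq0.
    by rewrite lerDr divr_ge0 ?sqr_ge0// ltW.
  rewrite /E; set D := d ^+ 2 / x J in h1' sq *.
  have lz : x (dleft J) * ln (z J) + x (dright J) * ln (z J) = 2 * (x J * ln (z J)).
    by rewrite -mulrDl x2 mulrA.
  rewrite /d in sq; clear h1 hx h2 zm.
  nra.
have Gl : levelsum G I N <= 17 * Q * (dlen I * x I).
  have add : dyadic_additive (fun J => 17 * Q * (dlen J * x J)).
    by move=> J; rewrite dlS drS [in LHS]xm; field.
  rewrite -(levelsum_additive I N add); apply: levelsum_le => J.
  by rewrite /G mulrCA ler_pM2l ?dlen_gt0.
have tel := treesum_telescope I N step.
have GI : 0 <= G I by rewrite mulr_ge0// ltW// dlen_gt0.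
apply: (@le_trans _ _ (8 * treesum (fun J => dlen J * (jump x J ^+ 2 / (32 * x J))) I N)).
  rewrite -treesumZ; apply: treesum_le => J.
  by rewrite le_eqVlt; apply/orP; left; apply/eqP; field; exact: lt0r_neq0.
lra.
Qed.

End DualInequality.

(** * Geometry of dyadic intervals *)

Section DyadicGeometry.
Context {R : realType}.
Implicit Types (I J L : dyadic).

Fixpoint descseq L (k : nat) : seq dyadic :=
  if k is k'.+1 then descseq (dleft L) k' ++ descseq (dright L) k' else [:: L].

Lemma levelsum_descseq (F : dyadic -> R) L k :
  levelsum F L k = \sum_(I <- descseq L k) F I.
Proof.
by elim: k L => [|k IH] L /=; rewrite ?big_seq1// big_cat/= !IH.
Qed.

(** Containment of half-open dyadic intervals reduces to the position of the left
    end point. *)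
Lemma mem_descseq L k I : (I \in descseq L k) =
  (I.1 == L.1 + k%:Z) && (2 ^+ k * L.2 <= I.2 < 2 ^+ k * (L.2 + 1)).
Proof.
elim: k L => [|k IH] L /=.
  rewrite inE addr0 expr0 !mul1r; case: I L => [i1 i2] [l1 l2] /=.
  apply/eqP/idP => [[-> ->]|/andP[/eqP -> h]]; first by rewrite eqxx; lia.
  by congr (_, _); lia.
rewrite mem_cat !IH /= exprS; move: (2 ^+ k) (exprn_gt0 k (ltr0n int 2)) => X X0; clear IH.
case: I L => [i1 i2] [l1 l2] /=.
have -> : (l1 + 1 + k%:Z)%R = (l1 + k.+1%:Z)%R by lia.
case: (i1 == _) => //=.
apply/orP/idP => [|h]; first by case=> h; nia.
by have [h1|h1] := ltP i2 (X * (2 * l2 + 1)); [left|right]; nia.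
Qed.

Lemma uniq_descseq L k : uniq (descseq L k).
Proof.
elim: k L => //= k IH L; rewrite cat_uniq !IH andbT /=.
apply/hasPn => I; rewrite !mem_descseq /= => /andP[_ h]; apply/negP => /andP[_ h'].
by move: h h'; move: (2 ^+ k) => X; lia.
Qed.

Lemma dlen_left I : dlen (dleft I) = dlen I / 2 :> R.
Proof. by rewrite /dlen /= opprD expfzDr ?pnatr_eq0. Qed.

Lemma dlen_right I : dlen (dright I) = dlen I / 2 :> R.
Proof. exact: dlen_left. Qed.

Lemma dset_left I : dset (dleft I) =
  `[I.2%:~R * dlen I, (I.2%:~R + 2^-1) * dlen I[%classic :> set R.
Proof.
have e1 : (2 * I.2)%:~R * (dlen I / 2) = I.2%:~R * dlen I :> R.
  by rewrite rmorphM /=; field.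
have e2 : (2 * I.2 + 1)%:~R * (dlen I / 2) = (I.2%:~R + 2^-1) * dlen I :> R.
  by rewrite rmorphD rmorphM /=; field.
by rewrite /dset dlen_left /= e1 e2.
Qed.

Lemma dset_right I : dset (dright I) =
  `[(I.2%:~R + 2^-1) * dlen I, (I.2 + 1)%:~R * dlen I[%classic :> set R.
Proof.
have e1 : (2 * I.2 + 1)%:~R * (dlen I / 2) = (I.2%:~R + 2^-1) * dlen I :> R.
  by rewrite rmorphD rmorphM /=; field.
have e2 : (2 * I.2 + 1 + 1)%:~R * (dlen I / 2) = (I.2 + 1)%:~R * dlen I :> R.
  by rewrite !rmorphD rmorphM /=; field.
by rewrite /dset dlen_right /= e1 e2.
Qed.

Lemma dset_halves I : dset I = dset (dleft I) `|` dset (dright I) :> set R.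
Proof.
rewrite dset_left dset_right; have h := @dlen_gt0 R I.
apply/seteqP; split=> x; rewrite /dset /= !in_itv /= rmorphD /= [1%:~R]/(1 : R) !mulrDl mul1r;
  move: (_ * dlen I) => y.
  move=> /andP[h1 h2].
  by have [h3|h3] := ltP x (y + 2^-1 * dlen I); [left|right]; rewrite ?h1 ?h2 ?h3.
by move=> [|] /andP[h1 h2]; apply/andP; split => //; lra.
Qed.

Lemma disjoint_halves I : [disjoint dset (dleft I) & (dset (dright I) : set R)].
Proof.
apply/disj_setPS => x [] /=; rewrite dset_left dset_right /= !in_itv/=.
by move=> /andP[_ h1] /andP[h2 _]; move: (lt_le_trans h1 h2); rewrite ltxx.
Qed.

Lemma measurable_dset I : measurable (dset I : set (measurableTypeR R)).
Proof. exact: measurable_itv. Qed.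

Lemma descendantsE k L : @descendants R k L = [set` descseq L k].
Proof.
have d0 := @dlen_gt0 R; have two0 : (2 : R) != 0 by rewrite pnatr_eq0.
have eqlen I : @dlen R I = 2 ^- k * dlen L -> I.1 = L.1 + k%:Z.
  have -> : (2 : R) ^- k = 2 ^ (- k%:Z) by rewrite exprnN.
  rewrite /dlen -expfzDr// => /ieexprIz; rewrite ltr0n gt_eqF ?ltr1n// => /(_ isT isT).
  lia.
apply/seteqP; split=> I /=.
  move=> [sub /[dup] lenE /eqlen i1]; rewrite mem_descseq i1 eqxx /=.
  have : dset I (I.2%:~R * dlen I : R).
    by rewrite /dset /= in_itv /= lexx ltr_pM2r// ltr_int ltrDl.
  move=> /sub; rewrite /dset /= in_itv /=.
  have -> : dlen L = 2 ^+ k * dlen I :> R by rewrite lenE mulVKf// expf_neq0.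
  rewrite !mulrA ler_pM2r// ltr_pM2r//.
  have -> : (2 : R) ^+ k = (2 ^+ k : int)%:~R by rewrite rmorphXn.
  by rewrite -!rmorphM /= ler_int ltr_int ![_ * 2 ^+ k]mulrC.
rewrite mem_descseq => /andP[/eqP i1 /andP[h1 h2]].
have lenE : dlen I = 2 ^- k * dlen L :> R.
  by rewrite /dlen i1 opprD expfzDr// mulrC exprnN.
split=> // x; rewrite /dset /= !in_itv /=.
have -> : dlen L = 2 ^+ k * dlen I :> R by rewrite lenE mulVKf// expf_neq0.
rewrite !mulrA => /andP[x1 x2]; apply/andP; split.
  apply: le_trans x1; rewrite ler_pM2r//.
  have -> : (2 : R) ^+ k = (2 ^+ k : int)%:~R by rewrite rmorphXn.
  by rewrite -!rmorphM /= ler_int mulrC.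
apply: lt_le_trans x2 _; rewrite ler_pM2r//.
have -> : (2 : R) ^+ k = (2 ^+ k : int)%:~R by rewrite rmorphXn.
by rewrite -!rmorphM /= ler_int mulrC lezD1.
Qed.

Lemma fsbig_descendants (F : dyadic -> R) k L :
  \sum_(I \in @descendants R k L) F I = levelsum F L k.
Proof.
by rewrite descendantsE -fsbig_seq ?uniq_descseq// levelsum_descseq.
Qed.

(** The two halves of the line are needed since no dyadic interval meets
    both of them. *)
Definition top_right (j : nat) : dyadic := (- j%:Z, 0).
Definition top_left (j : nat) : dyadic := (- j%:Z, -1).

Lemma finite_dyadic_tops (F : seq dyadic) : exists j N, forall L, L \in F ->
  exists2 k, (k < N)%N & L \in descseq (top_left j) k ++ descseq (top_right j) k.
Proof.
pose j := \max_(L <- F) (absz L.1 + absz L.2)%N.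
exists j, (j + j).+1 => L LF.
have hj : (absz L.1 + absz L.2 <= j)%N by exact: leq_bigmax_seq.
have [k kE] : exists k : nat, L.1 = - j%:Z + k%:Z.
  by exists (absz (L.1 + j%:Z)); lia.
have k2 : (absz L.2 < 2 ^ k)%N.
  by apply: leq_trans (ltn_expl k (ltnSn 1)); lia.
exists k; first lia.
have X2 : (2 ^+ k : int) = (2 ^ k)%N%:Z by rewrite -natrX natz.
by rewrite mem_cat !mem_descseq kE eqxx /= X2; lia.
Qed.

Lemma sum_le_of_subset (T : eqType) (s r : seq T) (F : T -> R) :
  uniq s -> {subset s <= r} -> (forall x, 0 <= F x) ->
  \sum_(x <- s) F x <= \sum_(x <- r) F x.
Proof.
move=> + + F0; elim: s r => [|a s IH] r /=.
  by move=> _ _; rewrite big_nil; apply: sumr_ge0.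
move=> /andP[as_ us] sr.
have ar : a \in r by apply: sr; rewrite mem_head.
rewrite big_cons (big_rem a ar) /= lerD2l; apply: IH => // x xs.
have xa : x != a by apply: contraNneq as_ => <-.
by have := sr x; rewrite inE xs orbT (perm_mem (perm_to_rem ar)) inE (negPf xa) => /(_ isT).
Qed.

Lemma treesum_flatten (F : dyadic -> R) I N :
  treesum F I N = \sum_(J <- flatten [seq descseq I k | k <- iota 0 N]) F J.
Proof.
rewrite big_flatten /= big_map /treesum -(big_mkord xpredT (levelsum F I)).
by rewrite /index_iota subn0; apply: eq_bigr => k _; exact: levelsum_descseq.
Qed.

(** Finite sums over dyadic intervals are thereby controlled by sums over two
    trees, the same two for all summands. *)
Lemma sum_le_treesum (F : seq dyadic) : uniq F -> exists j N,
  forall X : dyadic -> R, (forall L, 0 <= X L) ->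
  \sum_(L <- F) X L <= treesum X (top_left j) N + treesum X (top_right j) N.
Proof.
move=> uF; have [j [N h]] := finite_dyadic_tops F; exists j, N => X X0.
rewrite !treesum_flatten -big_cat; apply: sum_le_of_subset => // L /h[k kN].
rewrite !mem_cat => /orP[] Lk; apply/orP; [left|right];
  by apply/flattenP; eexists; [|exact: Lk]; apply: map_f; rewrite mem_iota.
Qed.

Lemma disjoint_tops j : [disjoint dset (top_left j) & (dset (top_right j) : set R)].
Proof.
apply/disj_setPS => x []; rewrite /dset /= !in_itv/=.
move=> /andP[_ h1] /andP[h2 _].
have {}h1 : x < 0%:~R * dlen (top_right j) := h1.
by move: (lt_le_trans h1 h2); rewrite ltxx.
Qed.

End DyadicGeometry.

(** * Integrals over dyadic intervals *)

Section DyadicIntegrals.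
Context {R : realType}.
Notation mu := (@lebesgue_measure R).
Implicit Types (I J L : dyadic) (f g h u v : R -> R) (D : set (measurableTypeR R)).

Definition dint h I : R := \int[mu]_(x in dset I) h x.

Definition dyadic_integrable h :=
  forall I, mu.-integrable (dset I) (EFin \o h).

Lemma integrable_scale D (c : R) h : measurable D ->
  mu.-integrable D (EFin \o h) -> mu.-integrable D (EFin \o (fun x => c * h x)).
Proof.
move=> mD hi; have := integrableZl mD c hi.
by apply: eq_integrable => // x _; rewrite /= EFinM.
Qed.

Lemma integrable_add D h g : measurable D ->
  mu.-integrable D (EFin \o h) -> mu.-integrable D (EFin \o g) ->
  mu.-integrable D (EFin \o (fun x => h x + g x)).
Proof.
move=> mD hi gi; have := integrableD mD hi gi.
by apply: eq_integrable => // x _; rewrite /= EFinD.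
Qed.

Lemma integrable_bigsum (T : eqType) D (s : seq T) (F : T -> R -> R) :
  measurable D -> (forall i, mu.-integrable D (EFin \o F i)) ->
  mu.-integrable D (EFin \o (fun x => \sum_(i <- s) F i x)).
Proof.
move=> mD hi; elim: s => [|a s IH].
  by under eq_fun do rewrite big_nil; exact: integrable0.
by under eq_fun do rewrite big_cons; exact: integrable_add.
Qed.

Lemma Rintegral_bigsum (T : eqType) D (s : seq T) (F : T -> R -> R) :
  measurable D -> (forall i, mu.-integrable D (EFin \o F i)) ->
  \int[mu]_(x in D) (\sum_(i <- s) F i x) = \sum_(i <- s) \int[mu]_(x in D) F i x.
Proof.
move=> mD hi; elim: s => [|a s IH].
  rewrite big_nil (@eq_Rintegral _ _ _ mu D (cst 0)) ?Rintegral_cst ?mul0r//.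
  by move=> x _; rewrite big_nil.
rewrite big_cons -IH -RintegralD//; last exact: integrable_bigsum.
by apply: eq_Rintegral => x _; rewrite big_cons.
Qed.

Lemma dyadic_integrableT h : mu.-integrable setT (EFin \o h) -> dyadic_integrable h.
Proof. by move=> hi I; apply: integrableS hi => //; exact: measurable_dset. Qed.

Lemma dint_additive h : dyadic_integrable h -> dyadic_additive (dint h).
Proof.
move=> hi J; rewrite /dint dset_halves Rintegral_setU//.
- exact: measurable_dset.
- exact: measurable_dset.
- by rewrite -dset_halves; exact: hi.
- exact: disjoint_halves.
Qed.

Lemma dint_tops_le h j : mu.-integrable setT (EFin \o h) -> (forall x, 0 <= h x) ->
  dint h (top_left j) + dint h (top_right j) <= \int[mu]_x h x.
Proof.
move=> hi h0; have mA := measurable_dset (R := R).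
rewrite /dint -Rintegral_setU//; last 2 first.
- by apply: integrableS hi => //; apply: measurableU; exact: measurable_dset.
- exact: disjoint_tops.
rewrite [leLHS]Rintegral_mkcond; apply: le_Rintegral => //.
- have mU : measurable (dset (top_left j) `|` dset (top_right j) : set (measurableTypeR R)).
    by apply: measurableU; exact: measurable_dset.
  rewrite -restrict_EFin; apply/(integrable_mkcond _ mU).
  by apply: integrableS hi.
- by move=> x _; rewrite patchE; case: ifP.
Qed.

Lemma restrict_indic h D x : h x * \1_D x = (h \_ D) x.
Proof. by rewrite indicE patchE; case: ifP => _; rewrite ?mulr1// mulr0. Qed.

Lemma integrable_indic_dset h J : dyadic_integrable h ->
  mu.-integrable setT (EFin \o (fun x => h x * \1_(dset J) x)).
Proof.
move=> hi; have := hi J; rewrite (integrable_mkcond _ (measurable_dset J)).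
rewrite restrict_EFin; apply: eq_integrable => // x _ /=.
by rewrite restrict_indic.
Qed.

Lemma integral_indic_dset h J : \int[mu]_x (h x * \1_(dset J) x) = dint h J.
Proof.
rewrite /dint [RHS]Rintegral_mkcond; apply: eq_Rintegral => x _.
exact: restrict_indic.
Qed.

(** The sum of sqrt|J| h_J over the descendants J of L of generation n. *)
Definition rademacher (n : nat) L (x : R) : R :=
  levelsum (fun J => \1_(dset (dright J)) x - \1_(dset (dleft J)) x) L n.

Lemma rademacher_integral h n L : dyadic_integrable h ->
  mu.-integrable setT (EFin \o (fun x => h x * rademacher n L x)) /\
  \int[mu]_x (h x * rademacher n L x) = levelsum (jump (dint h)) L n.
Proof.
move=> hi; rewrite /rademacher; elim: n L => [|n IH] L /=.
  have E x : h x * (\1_(dset (dright L)) x - \1_(dset (dleft L)) x) =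
      h x * \1_(dset (dright L)) x - h x * \1_(dset (dleft L)) x by rewrite mulrBr.
  have [iR iL] := (integrable_indic_dset (dright L) hi, integrable_indic_dset (dleft L) hi).
  split.
    apply: eq_integrable (integrableB _ iR iL) => // x _ /=.
    by rewrite E.
  transitivity (\int[mu]_x (h x * \1_(dset (dright L)) x -
      h x * \1_(dset (dleft L)) x)).
    by apply: eq_Rintegral => x _; rewrite E.
  by rewrite RintegralB// !integral_indic_dset.
have [iL eL] := IH (dleft L); have [iR eR] := IH (dright L).
under eq_fun do rewrite mulrDr.
split; first exact: integrable_add.
by rewrite RintegralD// eL eR.
Qed.

(** The integral of v (g - c)^2 is nonnegative, for c the v-average of g. *)
Lemma dint_cauchy_schwarz v g J : (forall x, 0 <= v x) ->
  mu.-integrable (dset J) (EFin \o v) ->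
  mu.-integrable (dset J) (EFin \o (fun x => v x * g x)) ->
  mu.-integrable (dset J) (EFin \o (fun x => v x * g x * g x)) ->
  0 < dint v J ->
  dint (fun x => v x * g x) J ^+ 2 <= dint v J * dint (fun x => v x * g x * g x) J.
Proof.
move=> v0 iv ig igg dv.
set A := dint (fun x => v x * g x) J.
set q := dint (fun x => v x * g x * g x) J.
have mJ := measurable_dset (R := R) J.
pose c := A / dint v J.
have : 0 <= \int[mu]_(x in dset J) (v x * g x * g x +
    ((-2 * c) * (v x * g x) + c ^+ 2 * v x)).
  apply: Rintegral_ge0 => x _.
  rewrite (_ : _ + _ = v x * (g x - c) ^+ 2); last by ring.
  by rewrite mulr_ge0 ?sqr_ge0.
rewrite RintegralD//; last first.
  by apply: integrable_add => //; exact: integrable_scale.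
rewrite RintegralD//; [|exact: integrable_scale|exact: integrable_scale].
rewrite !RintegralZl// -[X in 0 <= X -> _]/(q + (-2 * c * A + c ^+ 2 * dint v J)).
have -> : q + (-2 * c * A + c ^+ 2 * dint v J) = (dint v J * q - A ^+ 2) / dint v J.
  by rewrite /c; field; exact: lt0r_neq0.
by rewrite pmulr_lge0 ?invr_gt0// subr_ge0.
Qed.

Lemma sum_cauchy_schwarz (T : eqType) (s : seq T) (a b : T -> R) :
  (\sum_(i <- s) a i * b i) ^+ 2 <=
  (\sum_(i <- s) a i ^+ 2) * (\sum_(i <- s) b i ^+ 2).
Proof.
elim: s => [|x s IH]; first by rewrite !big_nil expr0n mul0r.
rewrite !big_cons; apply: cauchy_schwarz_pair; rewrite ?sqr_ge0//.
- by apply: sumr_ge0 => i _; exact: sqr_ge0.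
- by apply: sumr_ge0 => i _; exact: sqr_ge0.
- by rewrite exprMn.
Qed.

(** The global integrability of the product, and not only that on each interval,
    expresses that g is bounded with bounded support. *)
Definition dyadic_multiplier g := forall h, dyadic_integrable h ->
  mu.-integrable setT (EFin \o (fun x => h x * g x)).

Lemma dyadic_multiplier_rademacher (T : eqType) (F : seq T) (a : T -> R) n
    (L : T -> dyadic) :
  dyadic_multiplier (fun x => \sum_(i <- F) a i * rademacher n (L i) x).
Proof.
move=> h hi; under eq_fun do rewrite mulr_sumr.
apply: integrable_bigsum => // i.
under eq_fun do rewrite mulrCA.
by apply: integrable_scale => //; exact: (rademacher_integral n (L i) hi).1.
Qed.

(** Let X be the integral of v G^2, which is also the sum of a_L v(L)^(-1/2) times
    the integral of (v G) r_L.  By Cauchy-Schwarz and the dual inequality applied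
    to G itself, X^2 is at most (sum of a_L^2) K X, and X is finite. *)
Lemma square_integral_rademacher_le v n (B : R) (F : seq dyadic) (a : dyadic -> R) :
  uniq F -> 0 < B -> (forall x, 0 <= v x) -> dyadic_integrable v ->
  (forall J, 0 < dint v J) ->
  (forall J N, treesum (fun K => jump (dint v) K ^+ 2 / dint v K) J N <=
     B * dint v J) ->
  let G x := \sum_(L <- F) a L / Num.sqrt (dint v L) * rademacher n L x in
  mu.-integrable setT (EFin \o (fun x => v x * G x * G x)) /\
  \int[mu]_x (v x * G x * G x) <=
    (2 * n.+1%:R + 8 * B) * \sum_(L <- F) a L ^+ 2.
Proof.
move=> uF B0 v0 vi dv0 hB G.
have mG := dyadic_multiplier_rademacher F (fun L => a L / Num.sqrt (dint v L)) n id.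
have iG : mu.-integrable setT (EFin \o (fun x => v x * G x)) := mG _ vi.
have dG := dyadic_integrableT iG.
have iGG : mu.-integrable setT (EFin \o (fun x => v x * G x * G x)) := mG _ dG.
have dGG := dyadic_integrableT iGG.
split => //.
set A := dint (fun x => v x * G x).
set q := dint (fun x => v x * G x * G x).
set X := \int[mu]_x _; set S := \sum_(L <- F) _.
pose P L := levelsum (jump A) L n.
have X0 : 0 <= X.
  apply: Rintegral_ge0 => x _; rewrite -mulrA mulr_ge0// -expr2; exact: sqr_ge0.
have S0 : 0 <= S by apply: sumr_ge0 => L _; exact: sqr_ge0.
have XE : X = \sum_(L <- F) a L * (P L / Num.sqrt (dint v L)).
  rewrite /X; under eq_Rintegral do rewrite {2}/G mulr_sumr.
  have iL L := (rademacher_integral n L dG).1.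
  rewrite Rintegral_bigsum//; last first.
    move=> L; under eq_fun do rewrite mulrCA.
    by apply: integrable_scale.
  apply: eq_bigr => L _.
  under eq_Rintegral do rewrite mulrCA.
  rewrite RintegralZl//.
  by rewrite (rademacher_integral n L dG).2 mulrAC -mulrA.
have dual := fun I N => dual_inequality I N n B0 (dint_additive dG)
  (dint_additive vi) (dint_additive dGG) dv0 (fun J => dint_cauchy_schwarz v0
  (vi J) (dG J) (dGG J) (dv0 J)) hB.
set c := 2 * n.+1%:R + 8 * B in dual *.
have c0 : 0 <= c by rewrite addr_ge0// mulr_ge0// ltW.
have PX : \sum_(L <- F) (P L / Num.sqrt (dint v L)) ^+ 2 <= c * X.
  have [j [N hN]] := sum_le_treesum (R := R) uF.
  have XL L : (P L / Num.sqrt (dint v L)) ^+ 2 = P L ^+ 2 / dint v L.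
    by rewrite expr_div_n sqr_sqrtr// ltW.
  under eq_bigr do rewrite XL.
  apply: le_trans (hN _ _) _.
    by move=> L; rewrite divr_ge0 ?sqr_ge0// ltW.
  apply: le_trans (lerD (dual _ _) (dual _ _)) _.
  rewrite -mulrDr ler_wpM2l//; apply: dint_tops_le => // x.
  by rewrite -mulrA mulr_ge0// -expr2 sqr_ge0.
have : X ^+ 2 <= S * (c * X).
  by rewrite {1}XE; apply: le_trans (sum_cauchy_schwarz _ _ _) _; rewrite ler_wpM2l.
have [->|Xn] := eqVneq X 0; first by rewrite mulr_ge0.
have Xp : 0 < X by rewrite lt_neqAle eq_sym Xn.
by rewrite mulrA [S * c]mulrC expr2 ler_pM2r.
Qed.

End DyadicIntegrals.

(** * Square-integrable functions *)

Section SquareIntegrable.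
Context {R : realType}.
Notation mu := (@lebesgue_measure R).
Implicit Types (f g h u v : measurableTypeR R -> R).

Definition sqint g : \bar R := (\int[mu]_x ((g x) ^+ 2)%:E)%E.

Lemma sqint_ge0 g : (0 <= sqint g)%E.
Proof. by apply: integral_ge0 => x _; rewrite lee_fin sqr_ge0. Qed.

Lemma L2norm_sqint g : (L2norm g `^ 2 = sqint g)%E.
Proof.
rewrite /L2norm poweR_Lnorm//; apply: eq_integral => x _ /=.
by rewrite powR_mulrn// real_normK// num_real.
Qed.

Lemma L2norm_le g (r : R) : 0 <= r -> (sqint g <= (r ^+ 2)%:E)%E ->
  (L2norm g <= r%:E)%E.
Proof.
rewrite -L2norm_sqint => r0; have := Lnorm_ge0 mu 2%:E (EFin \o g).
rewrite -/(L2norm g); case: (L2norm g) => [s| |] //; last first.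
  by rewrite poweRyr ?pnatr_eq0.
rewrite lee_fin => s0; rewrite !lee_fin powR_mulrn// => h.
exact: le_of_sqr_le.
Qed.

Lemma L2norm_sqr g (r : R) : 0 <= r -> sqint g = (r ^+ 2)%:E -> L2norm g = r%:E.
Proof.
rewrite -L2norm_sqint => r0; have := Lnorm_ge0 mu 2%:E (EFin \o g).
rewrite -/(L2norm g); case: (L2norm g) => [s| |] //; last first.
  by rewrite poweRyr ?pnatr_eq0.
rewrite lee_fin => s0 []; rewrite powR_mulrn// => /eqP; rewrite eqrXn2// => /eqP ->//.
Qed.

Lemma L2_sqint g : measurable_fun setT g -> (sqint g < +oo)%E -> L2 g.
Proof.
move=> mg; rewrite -L2norm_sqint => fg; rewrite /L2 inE; apply/andP; split; rewrite inE//=.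
by rewrite /finite_norm; apply: (@lty_poweRy _ _ 2); [rewrite pnatr_eq0|exact: fg].
Qed.

Lemma L2_measurable g : L2 g -> measurable_fun setT g.
Proof. by rewrite /L2 inE => /andP[/[!inE]]. Qed.

Lemma L2_sqr_integrable g : L2 g ->
  mu.-integrable setT (EFin \o (fun x => g x ^+ 2)).
Proof. exact: Lfun2_integrable_sqr. Qed.

Lemma sqint_Rintegral g : mu.-integrable setT (EFin \o (fun x => g x ^+ 2)) ->
  sqint g = (\int[mu]_x (g x ^+ 2))%:E.
Proof. by move=> h; rewrite /sqint /Rintegral fineK//; exact: integrable_fin_num. Qed.

Lemma sqint_le f g : measurable_fun setT f -> measurable_fun setT g ->
  (forall x, f x ^+ 2 <= g x ^+ 2) -> (sqint f <= sqint g)%E.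
Proof.
move=> mf mg fg; apply: ge0_le_integral => //.
- by move=> x _; rewrite lee_fin sqr_ge0.
- by apply/measurable_EFinP; exact: measurable_funX.
- by apply/measurable_EFinP; exact: measurable_funX.
- by move=> x _; rewrite lee_fin.
Qed.

Lemma sqint_add_le f g : measurable_fun setT f -> measurable_fun setT g ->
  (sqint (fun x => f x + g x)%R <= 2%:E * sqint f + 2%:E * sqint g)%E.
Proof.
move=> mf mg; rewrite /sqint.
have m h : measurable_fun setT h ->
    measurable_fun setT (fun x => (2 * h x ^+ 2)%:E).
  by move=> mh; apply/measurable_EFinP/measurable_funM => //; exact: measurable_funX.
have e h : measurable_fun setT h ->
    (2%:E * \int[mu]_x (h x ^+ 2)%:E = \int[mu]_x (2 * h x ^+ 2)%:E)%E.
  move=> mh; rewrite -ge0_integralZl_EFin//.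
  - by move=> x _; rewrite lee_fin sqr_ge0.
  - by apply/measurable_EFinP; exact: measurable_funX.
rewrite !e// -ge0_integralD//; [|by move=> x _; rewrite lee_fin mulr_ge0 ?sqr_ge0
  |exact: m|by move=> x _; rewrite lee_fin mulr_ge0 ?sqr_ge0|exact: m].
apply: ge0_le_integral => //.
- by move=> x _; rewrite lee_fin sqr_ge0.
- by apply/measurable_EFinP; apply: measurable_funX; exact: measurable_funD.
- by apply: emeasurable_funD; exact: m.
- move=> x _; rewrite -EFinD lee_fin; have := sqr_ge0 (f x - g x); nra.
Qed.

Lemma sqint_ae_eq f g : measurable_fun setT f -> measurable_fun setT g ->
  {ae mu, forall x, f x = g x} -> sqint f = sqint g.
Proof.
move=> mf mg fg; apply: ge0_ae_eq_integral => //.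
- by apply/measurable_EFinP; exact: measurable_funX.
- by apply/measurable_EFinP; exact: measurable_funX.
- by move=> x _; rewrite lee_fin sqr_ge0.
- by move=> x _; rewrite lee_fin sqr_ge0.
- by apply: filterS fg => x /= ->.
Qed.

(** The increments are bounded by a geometric sequence of ratio 1/2. *)
Lemma cvg_of_sqr_series (a : nat -> R) (M : R) :
  (forall k, 4 ^+ k * (a k.+1 - a k) ^+ 2 <= M) -> cvgn a.
Proof.
move=> h; have M0 : 0 <= M by apply: le_trans (h 0%N); rewrite mulr_ge0 ?sqr_ge0.
pose d k := a k.+1 - a k.
have dle k : `|d k| <= geometric (Num.sqrt M) (2^-1) k.
  apply: le_of_sqr_le; first by rewrite /= mulr_ge0 ?sqrtr_ge0.
  rewrite real_normK ?num_real//= exprMn sqr_sqrtr// -exprM mulnC exprM exprVn.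
  rewrite (_ : 2 ^+ 2 = 4 :> R); last by rewrite -natrX.
  by rewrite exprVn ler_pdivlMr ?exprn_gt0// mulrC; exact: h.
have /normed_cvg cd : cvgn [normed series d].
  apply: (@series_le_cvg _ _ (geometric (Num.sqrt M) 2^-1)) => //.
  - by move=> n /=.
  - by move=> n; rewrite /= mulr_ge0 ?sqrtr_ge0 ?exprn_ge0.
  - by apply: is_cvg_geometric_series; rewrite ger0_norm ?invf_lt1 ?ltr1n.

have -> : a = (fun n => a 0%N + series d n).
  apply/funext => n; rewrite /series /= telescope_sumr//.
  by rewrite addrC subrK.
by apply: is_cvgD => //; exact: is_cvg_cst.
Qed.

(** The Riesz-Fischer theorem for sequences converging at a geometric rate: the
    series of 4^k (u_{k+1} - u_k)^2 is integrable, so u_k converges almost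
    everywhere, and Fatou's lemma transfers the estimates to the limit. *)
Lemma l2_complete (u : nat -> measurableTypeR R -> R) (K : R) :
  (forall k, measurable_fun setT (u k)) -> 
  (forall k l, (k <= l)%N ->
     (sqint (fun x => u l x - u k x)%R <= (K * 16 ^- k)%:E)%E) ->
  exists2 g : measurableTypeR R -> R, measurable_fun setT g &
    forall k : nat, (sqint (fun x => g x - u k x)%R <= (K * 16 ^- k)%:E)%E.
Proof.
move=> mu_ hu.
have K0 : 0 <= K.
  have := le_trans (sqint_ge0 _) (hu 0%N 0%N (leqnn _)).
  by rewrite lee_fin expr0 invr1 mulr1.
pose h k x := (4 ^+ k * (u k.+1 x - u k x) ^+ 2)%:E.
have mh k : measurable_fun setT (h k).
  apply/measurable_EFinP/measurable_funM => //.
  by apply: measurable_funX; exact: measurable_funB.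
have h0 k x : (0 <= h k x)%E by rewrite lee_fin mulr_ge0// sqr_ge0.
pose H x := (\sum_(0 <= k <oo) h k x)%E.
have mH : measurable_fun setT H by apply: ge0_emeasurable_sum => //.
have iH : mu.-integrable setT H.
  apply/integrableP; split => //.
  have -> : (\int[mu]_x `|H x| = \int[mu]_x H x)%E.
    by apply: eq_integral => x _; rewrite gee0_abs// nneseries_ge0.
  rewrite /H integral_nneseries//.
  apply: (@le_lt_trans _ _ (\sum_(0 <= k <oo) (K * 4 ^- k)%:E)%E).
    apply: lee_nneseries => [k _ _|k _]; first by apply: integral_ge0.
    rewrite /h; under eq_integral do rewrite EFinM.
    rewrite ge0_integralZl_EFin//; last 2 first.
    - by move=> x _; rewrite lee_fin sqr_ge0.
    - by apply/measurable_EFinP/measurable_funX; exact: measurable_funB.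
    apply: (@le_trans _ _ ((4 ^+ k)%:E * (K * 16 ^- k)%:E)%E).
      by apply: lee_pmul => //; [exact: sqint_ge0|exact: hu].
    rewrite -EFinM lee_fin (_ : 16 = 4 * 4 :> R); last by rewrite -natrM.
    by rewrite exprMn invfM mulrCA [4 ^+ k * _]mulrA divff ?mul1r// expf_neq0.
  have E k : (K * 4 ^- k)%:E = (geometric K 4^-1 k)%:E by rewrite /= exprVn.
  under eq_eseriesr do rewrite E.
  apply: le_lt_trans (ltry (K * (1 - 4^-1)^-1)).
  apply: lime_le.
    by apply: is_cvg_nneseries => k _ _; rewrite lee_fin /= mulr_ge0.
  apply: nearW => n; rewrite sumEFin lee_fin; apply: geometric_le_lim => //.
  by rewrite ger0_norm// invf_lt1// ltr1n.
have aeH : {ae mu, forall x, H x \is a fin_num}.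
  have := integrable_ae measurableT iH.
  by apply: filterS => x; exact.
pose A := [set x | (H x < +oo)%E].
have mA : measurable A.
  by rewrite -[A]setTI; exact: emeasurable_fun_infty_o.
(* The truncation to A makes the sequence converge everywhere. *)
pose u' k x := u k x * \1_A x.
have mu' k : measurable_fun setT (u' k).
  by apply: measurable_funM => //; exact: measurable_indic.
have cu' x : cvgn (u' ^~ x).
  have [xA|xA] := boolP (x \in A); last first.
    rewrite (_ : u' ^~ x = cst 0); first exact: is_cvg_cst.
    by apply/funext => k; rewrite /u' indicE (negPf xA) mulr0.
  have Hfin : H x \is a fin_num.
    rewrite ge0_fin_numE; first exact: set_mem xA.
    exact: nneseries_ge0.
  apply: (@cvg_of_sqr_series _ (fine (H x))) => k.
  rewrite /u' indicE xA !mulr1 -lee_fin fineK//.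
  apply: (@le_trans _ _ (\sum_(0 <= i < k.+1) h i x)%E).
    by rewrite big_nat_recr//= leeDr// sume_ge0.
  exact: nneseries_lim_ge.
pose g x := limn (u' ^~ x).
have mg : measurable_fun setT g.
  by apply: (measurable_fun_cvg mu') => x _; exact: cu'.
have main k : (sqint (fun x => g x - u' k x)%R <= (K * 16 ^- k)%:E)%E.
  pose f n x := ((u' (n + k)%N x - u' k x) ^+ 2)%:E.
  have mf n : measurable_fun setT (f n).
    by apply/measurable_EFinP/measurable_funX; exact: measurable_funB.
  have fE x : limn_einf (f ^~ x) = ((g x - u' k x) ^+ 2)%:E.
    apply: (cvg_limn_einf_sup _).1.
    apply: cvg_EFin; first exact: nearW.
    have cg : (u' (n + k)%N x - u' k x) @[n --> \oo] --> g x - u' k x.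
      apply: cvgB; last exact: cvg_cst.
      by have := cu' x; rewrite -(cvg_shiftn k).
    exact: (cvgM cg cg).
  have := @fatou _ _ _ mu setT measurableT f mf.
  under eq_integral do rewrite fE.
  move=> /(_ _)/le_trans; apply; first by move=> n x _; rewrite lee_fin sqr_ge0.
  rewrite limn_einf_lim; apply: lime_le; first exact: is_cvg_einfs.
  apply: nearW => n; apply: le_trans (hu k (n + k)%N (leq_addl _ _)).
  apply: (@le_trans _ _ (\int[mu]_x f n x)%E).
    by apply: ereal_inf_lbound; exists n => /=.
  apply: sqint_le; [exact: measurable_funB|exact: measurable_funB|move=> x].
  rewrite -mulrBl exprMn ler_piMr ?sqr_ge0// indicE.
exists g => // k; rewrite (sqint_ae_eq (g := fun x => g x - u' k x)).
- exact: main.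
- exact: measurable_funB.
- exact: measurable_funB.
- apply: filterS aeH => x; rewrite ge0_fin_numE; last exact: nneseries_ge0.
  by move=> Hx; rewrite /u' indicE mem_set// mulr1.
Qed.

End SquareIntegrable.

(** * Unconditionally convergent series in L^2 *)

Section UnconditionalSums.
Context {R : realType}.
Notation mu := (@lebesgue_measure R).
Implicit Types (f g : measurableTypeR R -> R).

#[local] Existing Instance totally_filter.

Lemma cvg_totally0 (a : {fset dyadic} -> \bar R) : (forall F, (0 <= a F)%E) ->
  (forall e : R, 0 < e ->
     exists A : {fset dyadic}, forall F, (A `<=` F)%fset -> (a F <= e%:E)%E) ->
  a F @[F --> (@totally dyadic)] --> 0%E.
Proof.
move=> a0 h; have near_le (e : R) : 0 < e -> \forall F \near @totally dyadic, (a F <= e%:E)%E.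
  by move=> /h[A hA]; exists A.
apply/fine_cvgP; split.
  apply: filterS (near_le 1 ltr01) => F aF.
  by rewrite ge0_fin_numE//; apply: le_lt_trans aF (ltry _).
apply/cvgrPdist_le => e e0; apply: filterS (near_le e e0) => F aF.
rewrite sub0r normrN /= ger0_norm ?fine_ge0//.
by rewrite -lee_fin fineK// ge0_fin_numE//; apply: le_lt_trans aF (ltry _).
Qed.

Lemma L2normN g : L2norm (fun x => - g x) = L2norm g.
Proof. by rewrite /L2norm -[RHS]oppe_Lnorm. Qed.

Lemma sum_fset_subset (V : zmodType) (F : dyadic -> V) (A B : {fset dyadic}) : (A `<=` B)%fset ->
  \sum_(i <- B) F i = \sum_(i <- A) F i + \sum_(i <- (B `\` A)%fset) F i.
Proof.
move=> AB; rewrite -big_cat; apply: perm_big; apply: uniq_perm => //.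
- by rewrite cat_uniq !fset_uniq andbT /=; apply/hasPn => x; rewrite in_fsetD => /andP[].
- move=> x; rewrite mem_cat in_fsetD; case: (boolP (x \in A)) => //= xA.
  exact: (fsubsetP AB).
Qed.

(** Choose finite sets H_k whose e-mass is within 16^-k of the supremum.  Adding
    any further indices to H_k changes the partial sum by at most 4^-k in norm. *)
Lemma unconditional_sum (phi : dyadic -> measurableTypeR R -> R) (e : dyadic -> R) (S : R) :
  (forall L, measurable_fun setT (phi L)) -> (forall L, 0 <= e L) ->
  (forall F : {fset dyadic},
     (sqint (fun x => \sum_(L <- F) phi L x)%R <= (\sum_(L <- F) e L)%:E)%E) ->
  (forall F : {fset dyadic}, \sum_(L <- F) e L <= S) ->
  exists g, L2 g /\
    L2norm (fun x => \sum_(L <- F) phi L x - g x) @[F --> (@totally dyadic)] --> 0%E.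
Proof.
move=> mphi e0 hphi hS.
pose u (F : {fset dyadic}) x := \sum_(L <- F) phi L x.
have mu_ F : measurable_fun setT (u F) by exact: measurable_sum.
pose E := [set \sum_(L <- F) e L | F in [set: {fset dyadic}]].
have supE : has_sup E.
  split; first by exists (\sum_(L <- fset0) e L), fset0.
  by exists S => _ [F _ <-].
have /choice[F hF] : forall k : nat, exists F : {fset dyadic},
    sup E - 16 ^- k < \sum_(L <- F) e L.
  move=> k; have k0 : (0 : R) < 16 ^- k by rewrite invr_gt0 exprn_gt0.
  by have [_ [F _ <-] hF] := sup_adherent k0 supE; exists F.
pose fix H k : {fset dyadic} := if k is k'.+1 then (H k' `|` F k)%fset else F 0%N.
have FH k : (F k `<=` H k)%fset by case: k => //= k; exact: fsubsetUr.
have mono k l : (k <= l)%N -> (H k `<=` H l)%fset.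
  elim: l => [|l IH]; first by rewrite leqn0 => /eqP ->.
  rewrite leq_eqVlt => /orP[/eqP ->//|]; rewrite ltnS => /IH /fsubset_trans; apply.
  exact: fsubsetUl.
have tail k (A : {fset dyadic}) : (H k `<=` A)%fset ->
    (sqint (fun x => u A x - u (H k) x)%R <= (16 ^- k)%:E)%E.
  move=> HA; rewrite (_ : (fun x => _) = u (A `\` H k)%fset); last first.
    by apply/funext => x; rewrite /u (sum_fset_subset _ HA) addrAC subrr add0r.
  apply: le_trans (hphi _) _; rewrite lee_fin.
  have h1 : \sum_(L <- A) e L <= sup E by apply: ub_le_sup; [exact: supE.2|exists A].
  have h2 := hF k; have h3 := sum_fset_subset e HA; have h4 := sum_fset_subset e (FH k).
  have h5 : 0 <= \sum_(i <- (H k `\` F k)%fset) e i by apply: sumr_ge0.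
  lra.
have [] := @l2_complete R (fun k => u (H k)) 1.
- by move=> k; exact: mu_.
- by move=> k l kl; rewrite mul1r; apply: tail; exact: mono.
move=> g mg hg; exists g; split.
  apply: L2_sqint => //.
  rewrite (_ : g = fun x => (g x - u (H 0%N) x) + u (H 0%N) x); last first.
    by apply/funext => x; rewrite subrK.
  apply: le_lt_trans (sqint_add_le _ _) _; [exact: measurable_funB|exact: mu_|].
  apply: lte_add_pinfty; apply: lte_mul_pinfty => //.
  - exact: le_lt_trans (hg 0%N) (ltry _).
  - exact: le_lt_trans (hphi _) (ltry _).
apply: cvg_totally0 => [A|eps eps0]; first exact: Lnorm_ge0.
have [k hk] : exists k : nat, 2 * 4 ^- k <= eps.
  have : (fun k : nat => 2 * (4^-1 : R) ^+ k) @ \oo --> (0 : R).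
    by apply: cvg_geometric; rewrite ger0_norm// invf_lt1// ltr1n.
  move/cvgrPdist_le => /(_ _ eps0)[k _ /(_ k (leqnn k))] /=.
  by rewrite sub0r normrN exprVn ger0_norm// => ?; exists k.
exists (H k) => A HA; apply: le_trans (_ : (2 * 4 ^- k)%:E <= _)%E; last by rewrite lee_fin.
apply: L2norm_le; first by [].
rewrite (_ : (fun x => _) = fun x => (u A x - u (H k) x) + (- (g x - u (H k) x))); last first.
  by apply/funext => x; rewrite opprB addrA subrK.
apply: le_trans (sqint_add_le _ _) _.
- exact: measurable_funB.
- by apply: measurableT_comp => //; exact: measurable_funB.
have hN : (sqint (fun x => - (g x - u (H k) x))%R <= (16 ^- k)%:E)%E.
  by rewrite /sqint; under eq_integral do rewrite sqrrN; have := hg k; rewrite mul1r.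
apply: (@le_trans _ _ (2%:E * (16 ^- k)%:E + 2%:E * (16 ^- k)%:E)%E).
  by apply: leeD; rewrite lee_pmul2l// ?tail.
rewrite -!EFinM -EFinD lee_fin exprMn exprVn -exprM mulnC exprM.
rewrite (_ : 4 ^+ 2 = 16 :> R); last by rewrite -natrX.
by rewrite le_eqVlt; apply/orP; left; apply/eqP; ring.
Qed.

Lemma L2norm_sum_limit_le (phi : dyadic -> measurableTypeR R -> R) g (M : R) :
  (forall L, measurable_fun setT (phi L)) -> measurable_fun setT g ->
  L2norm (fun x => \sum_(L <- F) phi L x - g x) @[F --> (@totally dyadic)] --> 0%E ->
  (forall F : {fset dyadic}, (L2norm (fun x => \sum_(L <- F) phi L x)%R <= M%:E)%E) ->
  (L2norm g <= M%:E)%E.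
Proof.
move=> mphi mg cv hM; apply/lee_addgt0Pr => eps eps0.
pose a (F : {fset dyadic}) := L2norm (fun x => \sum_(L <- F) phi L x - g x).
have {}cv : a F @[F --> @totally dyadic] --> 0%E := cv.
have : \forall F \near @totally dyadic, (a F < eps%:E)%E.
  have /fine_cvgP[fin /cvgrPdist_lt/(_ _ eps0) lte] := cv.
  apply: filterS2 fin lte => F Ffin /=; rewrite sub0r normrN => /(le_lt_trans (ler_norm _)).
  by rewrite -lte_fin fineK.
move=> [A _ /(_ A (fsubset_refl A)) /= hA].
pose u x := \sum_(L <- A) phi L x.
have mu_ : measurable_fun setT u by exact: measurable_sum.
have -> : L2norm g = L2norm (u \+ (fun x => - (u x - g x))).
  by congr L2norm; apply/funext => x /=; rewrite opprB addrC subrK.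
apply: le_trans (minkowski_EFin _ _ _ _) _ => //.
- by apply: measurableT_comp => //; exact: measurable_funB.
- by rewrite ler1n.
apply: leeD; first exact: hM.
by rewrite -/(L2norm _) L2normN ltW.
Qed.

End UnconditionalSums.

(** * The t-Haar multiplier as a series of Rademacher functions *)

Section HaarMultiplier.
Context {R : realType}.
Notation mu := (@lebesgue_measure R).
Implicit Types (f g w : R -> R) (I J L : dyadic).

Lemma integrable_one_dset I : mu.-integrable (dset I) (EFin \o cst (1 : R)).
Proof.
have mI := measurable_dset (R := R) I.
apply/integrableP; split; first by apply/measurable_EFinP.
under eq_integral do rewrite /= normr1.
rewrite integral_cst// mul1e; apply: le_lt_trans (ltry (dlen I)).
by rewrite -(lebesgue_measure_dset I).
Qed.

(** By |f| <= 1 + f^2. *)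
Lemma L2_dyadic_integrable f : L2 f -> dyadic_integrable f.
Proof.
move=> fL2 I; have mI := measurable_dset (R := R) I.
have i1 : mu.-integrable (dset I) (EFin \o (fun x => 1 + f x ^+ 2)).
  apply: integrable_add => //.
  - exact: integrable_one_dset.
  - exact: dyadic_integrableT (L2_sqr_integrable fL2) I.
apply: le_integrable i1 => //.
- by apply/measurable_EFinP; exact: measurable_funTS (L2_measurable fL2).
- move=> x _; rewrite /= lee_fin [leRHS]ger0_norm ?addr_ge0 ?sqr_ge0//.
  have := sqr_ge0 (`|f x| - 1); rewrite -(real_normK (num_real (f x))).
  by have := sqr_ge0 (`|f x|); nra.
Qed.

Lemma L2dot_haar f I : dyadic_integrable f ->
  Num.sqrt (dlen I) * L2dot f (haar I) = jump (dint f) I.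
Proof.
move=> fi; have [i0 e0] := rademacher_integral 0 I fi.
have s0 : Num.sqrt (dlen I) != 0 :> R by rewrite gt_eqF// sqrtr_gt0 dlen_gt0.
rewrite -[RHS]e0 /L2dot.
under eq_Rintegral do rewrite /haar mulrCA.
by rewrite RintegralZl// mulrA divff// mul1r.
Qed.

Lemma haar_rademacher I x : Num.sqrt (dlen I) * haar I x = rademacher 0 I x :> R.
Proof. by rewrite /haar mulrA divff ?mul1r// gt_eqF// sqrtr_gt0 dlen_gt0. Qed.

(** The double sum over I and J factors, since sqrt|I| <f, h_I> is the difference
    of the integrals of f over the two halves of I. *)
Lemma tHaar_termE t m n w f L x : dyadic_integrable f ->
  tHaar_term t m n w f L x = w x `^ t *
    (levelsum (jump (dint f)) L m / (dlen L * fine (mean w L) `^ t) *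
       rademacher n L x).
Proof.
move=> fi; rewrite /tHaar_term fsbig_descendants.
pose c := w x `^ t / (dlen L * fine (mean w L) `^ t).
rewrite (eq_levelsum _ _ (G := fun I => (c * rademacher n L x) * jump (dint f) I)).
  by rewrite levelsumZ /c; ring.
move=> I; rewrite fsbig_descendants.
rewrite (eq_levelsum _ _ (G := fun J => (c * jump (dint f) I) *
    (\1_(dset (dright J)) x - \1_(dset (dleft J)) x))).
  by rewrite levelsumZ mulrAC.
move=> J; have := haar_rademacher J x; rewrite /rademacher /= => <-.
rewrite -(L2dot_haar _ fi) sqrtrM ?ltW ?dlen_gt0// /c invfM.
ring.
Qed.

(** Bessel's inequality up to the factor m + 1.  It is [oscillation_bound] for the
    Lebesgue measure, which gives equal mass to the two halves, so that the
    averages disappear. *)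
Lemma haar_coefficients_bound m f (F : {fset dyadic}) : L2 f ->
  \sum_(L <- F) levelsum (jump (dint f)) L m ^+ 2 / dlen L <=
  m.+1%:R * \int[mu]_x (f x ^+ 2).
Proof.
move=> fL2; have fi := L2_dyadic_integrable fL2.
have f2 := L2_sqr_integrable fL2; have df2 := dyadic_integrableT f2.
have addl : dyadic_additive (@dlen R) by move=> J; rewrite dlen_left dlen_right; field.
have d1 J : dint (cst 1) J = dlen J :> R.
  have mJ := measurable_dset (R := R) J.
  rewrite /dint Rintegral_cst// mul1r; exact: (congr1 fine (lebesgue_measure_dset J)).
have CS J : dint f J ^+ 2 <= dlen J * dint (fun x => f x ^+ 2) J.
  have E1 : (fun x => cst 1 x * f x) = f by apply/funext => x; rewrite mul1r.
  have E2 : (fun x => cst 1 x * f x * f x) = (fun x => f x ^+ 2).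
    by apply/funext => x; rewrite mul1r.
  have := @dint_cauchy_schwarz R (cst 1) f J; rewrite E1 E2 !d1; apply => //.
  - exact: integrable_one_dset.
  - exact: dlen_gt0.
have osc I N := oscillation_bound I N m (dint_additive fi) addl
  (dint_additive df2) (@dlen_gt0 R) CS.
have [j [N hN]] := sum_le_treesum (R := R) (fset_uniq F).
apply: le_trans (hN _ _) _.
  by move=> L; rewrite divr_ge0 ?sqr_ge0// ltW ?dlen_gt0.
have jump0 J : jump (@dlen R) J = 0 by rewrite /jump dlen_left dlen_right subrr.
have lev0 L k : levelsum (jump (@dlen R)) L k = 0.
  elim: k L => [|k IH] L /=; first exact: jump0.
  by rewrite !IH addr0.
have {}osc I M : treesum (fun L => levelsum (jump (dint f)) L m ^+ 2 / dlen L) I M <=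
    m.+1%:R * dint (fun x => f x ^+ 2) I.
  apply: le_trans (osc I M); apply: treesum_le => J.
  by rewrite lev0 mulr0 subr0.
apply: le_trans (lerD (osc _ _) (osc _ _)) _.
rewrite -mulrDr ler_wpM2l//; apply: dint_tops_le => // x; exact: sqr_ge0.
Qed.

Section Bound.
Variables (t : R) (m n : nat) (w : R -> R) (C B : R).
Let v x := w x `^ (2 * t).
Hypotheses (mw : measurable_fun setT w) (vi : dyadic_integrable v)
  (dv0 : forall J, 0 < dint v J) (C0 : 0 < C) (B0 : 0 < B)
  (mean0 : forall L, 0 < fine (mean w L))
  (hC : forall L, dint v L / dlen L <= C * fine (mean w L) `^ (2 * t))
  (hB : forall J N, treesum (fun K => jump (dint v) K ^+ 2 / dint v K) J N <=
     B * dint v J).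

Let K0 : R := 2 * n.+1%:R + 8 * B.

Let K0_ge0 : 0 <= K0.
Proof. by rewrite addr_ge0// mulr_ge0// ltW. Qed.

Lemma tHaar_finite_sum f (F : {fset dyadic}) : L2 f ->
  (sqint (fun x => \sum_(L <- F) tHaar_term t m n w f L x)%R <=
   (\sum_(L <- F) K0 * C * (levelsum (jump (dint f)) L m ^+ 2 / dlen L))%:E)%E.
Proof.
move=> fL2; have fi := L2_dyadic_integrable fL2.
pose c L := levelsum (jump (dint f)) L m / (dlen L * fine (mean w L) `^ t).
pose a L := c L * Num.sqrt (dint v L).
have v0 x : 0 <= v x by exact: powR_ge0.
have := square_integral_rademacher_le n a (fset_uniq F) B0 v0 vi dv0 hB.
set G := fun x => \sum_(L <- F) a L / _ * _ => -[iG leG].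
have E x : (\sum_(L <- F) tHaar_term t m n w f L x) ^+ 2 = v x * G x * G x.
  have -> : \sum_(L <- F) tHaar_term t m n w f L x = w x `^ t * G x.
    rewrite /G mulr_sumr; apply: eq_bigr => L _.
    by rewrite tHaar_termE// /a mulfK// gt_eqF// sqrtr_gt0.
  have -> : v x = w x `^ t ^+ 2.
    by rewrite /v mulrC powRrM powR_mulrn ?powR_ge0.
  by rewrite exprMn expr2 [G x ^+ 2]expr2 !mulrA.
rewrite sqint_Rintegral; last by under eq_fun do rewrite E.
rewrite lee_fin; under eq_Rintegral do rewrite E.
apply: le_trans leG _; rewrite -/K0 mulr_sumr.
apply: ler_sum => L _; rewrite -mulrA ler_wpM2l//.
rewrite /a exprMn (sqr_sqrtr (ltW (dv0 L))) /c expr_div_n.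
set l := levelsum _ _ _ ^+ 2; set d := dlen L; set p := fine (mean w L).
have d0 : 0 < d by exact: dlen_gt0.
have p0 : 0 < p by exact: mean0.
have pt0 : 0 < p `^ t by exact: powR_gt0.
have pE : p `^ (2 * t) = (p `^ t) ^+ 2 by rewrite mulrC powRrM powR_mulrn ?powR_ge0.
have h := hC L; rewrite -/d -/p pE in h.
have -> : l / (d * p `^ t) ^+ 2 * dint v L =
    (l / d) * ((dint v L / d) / (p `^ t) ^+ 2).
  by field; rewrite !gt_eqF.
have ld0 : 0 <= l / d by rewrite divr_ge0 ?sqr_ge0// ltW.
rewrite [leRHS]mulrC ler_wpM2l//.
by rewrite ler_pdivrMr// exprn_gt0.
Qed.

Lemma measurable_tHaar_term f L : L2 f ->
  measurable_fun setT (tHaar_term t m n w f L : measurableTypeR R -> R).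
Proof.
move=> fL2; have fi := L2_dyadic_integrable fL2.
rewrite (_ : tHaar_term t m n w f L = fun x => w x `^ t *
  (levelsum (jump (dint f)) L m / (dlen L * fine (mean w L) `^ t) *
     rademacher n L x)); last by apply/funext => x; exact: tHaar_termE.
have mr : measurable_fun setT (rademacher n L : measurableTypeR R -> R).
  rewrite /rademacher; elim: n L => [|k IH] J /=.
    by apply: measurable_funB; apply: measurable_indic; exact: measurable_dset.
  by apply: measurable_funD; exact: IH.
apply: measurable_funM; first exact: (measurableT_comp (measurable_powR _)).
by apply: measurable_funM.
Qed.

Let e_ge0 f L : 0 <= K0 * C * (levelsum (jump (dint f)) L m ^+ 2 / dlen L).
Proof.
apply: mulr_ge0; first by rewrite mulr_ge0// ltW.
by rewrite divr_ge0 ?sqr_ge0// ltW ?dlen_gt0.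
Qed.

Let e_sum f (F : {fset dyadic}) : L2 f ->
  \sum_(L <- F) K0 * C * (levelsum (jump (dint f)) L m ^+ 2 / dlen L) <=
  K0 * C * (m.+1%:R * \int[mu]_x (f x ^+ 2)).
Proof.
move=> fL2; rewrite -mulr_sumr ler_wpM2l//; first by rewrite mulr_ge0// ltW.
exact: haar_coefficients_bound.
Qed.

Lemma tHaar_exists f : L2 f -> exists g, tHaar t m n w f g.
Proof.
move=> fL2; apply: (unconditional_sum _ (e_ge0 f)).
- by move=> L; exact: measurable_tHaar_term.
- by move=> F; exact: tHaar_finite_sum.
- by move=> F; exact: e_sum.
Qed.

Lemma tHaar_bound f g : L2 f -> tHaar t m n w f g ->
  (L2norm g <= (Num.sqrt (K0 * m.+1%:R * C))%:E * L2norm f)%E.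
Proof.
move=> fL2 [gL2 cv]; set S := \int[mu]_x (f x ^+ 2).
have S0 : 0 <= S by apply: Rintegral_ge0 => x _; exact: sqr_ge0.
have -> : L2norm f = (Num.sqrt S)%:E.
  by apply: L2norm_sqr; rewrite ?sqrtr_ge0// sqr_sqrtr// sqint_Rintegral//;
    exact: L2_sqr_integrable.
have KC : 0 <= K0 * m.+1%:R * C by rewrite mulr_ge0 ?mulr_ge0// ltW.
rewrite -EFinM; apply: (L2norm_sum_limit_le _ (L2_measurable gL2) cv).
  by move=> L; exact: measurable_tHaar_term.
move=> F; apply: L2norm_le; first by rewrite mulr_ge0 ?sqrtr_ge0.
apply: le_trans (tHaar_finite_sum F fL2) _.
rewrite lee_fin exprMn !sqr_sqrtr//; apply: le_trans (e_sum F fL2) _.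
by rewrite -/S le_eqVlt; apply/orP; left; apply/eqP; ring.
Qed.

End Bound.

End HaarMultiplier.

(** * Averages of weights *)

Section Averages.
Context {R : realType}.
Notation mu := (@lebesgue_measure R).
Implicit Types (f g h u v w : R -> R) (I J L : dyadic) (q s t : R).

Lemma ae_imp (P Q : R -> Prop) : (forall x, P x -> Q x) ->
  {ae mu, forall x, P x} -> {ae mu, forall x, Q x}.
Proof. exact: (@filterS _ _ (ae_filter_ringOfSetsType mu)). Qed.

Lemma ae_imp2 (P P' Q : R -> Prop) : (forall x, P x -> P' x -> Q x) ->
  {ae mu, forall x, P x} -> {ae mu, forall x, P' x} -> {ae mu, forall x, Q x}.
Proof. exact: (@filterS2 _ _ (ae_filter_ringOfSetsType mu)). Qed.

Definition avg h J : R := dint h J / dlen J.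

Lemma dint_avg h J : dint h J = dlen J * avg h J.
Proof. by rewrite /avg mulrC divfK// gt_eqF// dlen_gt0. Qed.

Lemma meanE h J : mu.-integrable (dset J) (EFin \o h) -> mean h J = (avg h J)%:E.
Proof.
move=> hi; rewrite /mean /avg mulrC EFinM; congr (_ * _)%E.
by rewrite /dint /Rintegral fineK//; exact: (integrable_fin_num (measurable_dset J) hi).
Qed.

Lemma avg_midpoint h J : dyadic_integrable h ->
  avg h J = (avg h (dleft J) + avg h (dright J)) / 2.
Proof.
move=> hi; rewrite /avg (dint_additive hi) dlen_left dlen_right.
by field; rewrite gt_eqF// dlen_gt0.
Qed.

Lemma mean_ae_eq f g J : measurable_fun setT f -> measurable_fun setT g ->
  {ae mu, forall x, f x = g x} -> mean f J = mean g J.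
Proof.
move=> mf mg fg; congr (_ * _)%E; apply: ae_eq_integral.
- exact: measurable_dset.
- by apply/measurable_EFinP; exact: measurable_funTS.
- by apply/measurable_EFinP; exact: measurable_funTS.
- by apply: (ae_imp _ fg) => x /= ->.
Qed.

Lemma dint_ge0_ae h J : mu.-integrable (dset J) (EFin \o h) ->
  {ae mu, forall x, 0 <= h x} -> 0 <= dint h J.
Proof.
move=> hi h0; have mJ := measurable_dset (R := R) J.
have mh : measurable_fun (dset J : set (measurableTypeR R)) h.
  by apply/measurable_EFinP; exact: (measurable_int mu hi).
rewrite /dint (_ : Rintegral _ _ _ = \int[mu]_(x in dset J) `|h x|).
  exact: Rintegral_ge0.
congr fine; apply: ae_eq_integral => //.
- by apply/measurable_EFinP.
- by apply/measurable_EFinP; exact: measurableT_comp.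
- by apply: (ae_imp _ h0) => x hx _; rewrite ger0_norm.
Qed.

Lemma avg_le_ae f g J : mu.-integrable (dset J) (EFin \o f) ->
  mu.-integrable (dset J) (EFin \o g) ->
  {ae mu, forall x, f x <= g x} -> avg f J <= avg g J.
Proof.
move=> fi gi fg; have mJ := measurable_dset (R := R) J.
rewrite /avg ler_pM2r ?invr_gt0 ?dlen_gt0// -subr_ge0.
rewrite /dint -RintegralB//; apply: dint_ge0_ae.
  by apply: eq_integrable (integrableB mJ gi fi) => // x _; rewrite /= EFinB.
by apply: (ae_imp _ fg) => x; rewrite subr_ge0.
Qed.

Lemma avg_affine a b h J : mu.-integrable (dset J) (EFin \o h) ->
  mu.-integrable (dset J) (EFin \o (fun x => a + b * h x)) /\
  avg (fun x => a + b * h x) J = a + b * avg h J.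
Proof.
move=> hi; have mJ := measurable_dset (R := R) J.
have i1 := integrable_scale b mJ hi.
have ia : mu.-integrable (dset J) (EFin \o cst a).
  have := integrable_scale a mJ (integrable_one_dset J).
  by apply: eq_integrable => // x _ /=; rewrite mulr1.
split; first exact: integrable_add.
rewrite /avg /dint RintegralD// Rintegral_cst// RintegralZl//.
have -> : fine (mu (dset J)) = dlen J by exact: (congr1 fine (lebesgue_measure_dset J)).
by field; rewrite gt_eqF// dlen_gt0.
Qed.

Lemma avg_gt0 h J : mu.-integrable (dset J) (EFin \o h) ->
  {ae mu, forall x, 0 < h x} -> 0 < avg h J.
Proof.
move=> hi h0; have mJ := measurable_dset (R := R) J.
have mh : measurable_fun (dset J : set (measurableTypeR R)) h.
  by apply/measurable_EFinP; exact: (measurable_int mu hi).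
have h0' : {ae mu, forall x, 0 <= h x} by apply: (ae_imp _ h0) => x /ltW.
have d0 := dint_ge0_ae hi h0'.
rewrite /avg divr_gt0 ?dlen_gt0// lt_neqAle d0 andbT eq_sym.
apply/eqP => dh; have abs0 : (\int[mu]_(x in dset J) `|(h x)%:E| = 0)%E.
  transitivity (\int[mu]_(x in dset J) (h x)%:E)%E.
    apply: ae_eq_integral => //.
    - by apply: measurableT_comp => //; exact/measurable_EFinP.
    - exact/measurable_EFinP.
    - by apply: (ae_imp _ h0') => x hx _; rewrite gee0_abs.
  rewrite -[LHS]fineK; first by rewrite -/(Rintegral _ _ _) -/(dint h J) dh.
  exact: integrable_fin_num.
have mEh : measurable_fun (dset J : set (measurableTypeR R)) (EFin \o h).
  exact/measurable_EFinP.
have hz := (ae_eq_integral_abs mu mJ mEh).1 abs0.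
have [N [mN N0 sub]] : {ae mu, forall x, ~ (dset J x)}.
  apply: (ae_imp2 _ h0 hz) => x hx hz0 Jx; have := hz0 Jx => -[] hx0.
  by rewrite hx0 ltxx in hx.
have : (mu (dset J) <= mu N)%E.
  by apply: le_measure; rewrite ?inE//; move=> x Jx; apply: sub => /(_ Jx).
have -> : mu (dset J) = (dlen J)%:E by exact: lebesgue_measure_dset.
by rewrite N0 lee_fin leNgt dlen_gt0.
Qed.

(** Jensen's inequality, by integrating the tangent line of ln at the average. *)
Lemma avg_ln_le g J : mu.-integrable (dset J) (EFin \o g) ->
  mu.-integrable (dset J) (EFin \o (fun x => ln (g x))) ->
  {ae mu, forall x, 0 < g x} -> avg (fun x => ln (g x)) J <= ln (avg g J).
Proof.
move=> gi lgi g0; have a0 := avg_gt0 gi g0; set a := avg g J in a0 *.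
have [i e] := avg_affine (ln a - 1) a^-1 gi.
apply: (@le_trans _ _ (avg (fun x => (ln a - 1) + a^-1 * g x) J)).
  apply: avg_le_ae => //; apply: (ae_imp _ g0) => x gx.
  have := ln_le_sub1 (divr_gt0 gx a0); rewrite ln_div ?posrE// mulrC; lra.
by rewrite e -/a mulVf ?gt_eqF// subrK.
Qed.

Lemma measurable_powR_fun s g : measurable_fun setT (g : measurableTypeR R -> R) ->
  measurable_fun setT (fun x : measurableTypeR R => g x `^ s).
Proof. by move=> mg; apply: (measurableT_comp (measurable_powR _)). Qed.

Lemma dyadic_integrable_powR s g : measurable_fun setT (g : measurableTypeR R -> R) ->
  0 <= s <= 1 -> dyadic_integrable g -> dyadic_integrable (fun x => g x `^ s).
Proof.
move=> mg s01 gi J; have mJ := measurable_dset (R := R) J.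
have i1 := integrable_add mJ (integrable_one_dset J) (integrable_norm (gi J)).
apply: le_integrable i1 => //.
  by apply/measurable_EFinP; apply: measurable_funTS; exact: measurable_powR_fun.
move=> x _; rewrite /= lee_fin [leLHS]ger0_norm ?powR_ge0// [leRHS]ger0_norm ?addr_ge0//.
have [gx|gx|->] := ltgtP (g x) 0.
- by rewrite lt0_powR1//= lerDl normr_ge0.
- apply: le_trans (powR_le_tangent gx s01) _; case/andP: s01 => s0 s1.
  by rewrite (ger0_norm (ltW gx)); nra.
- rewrite normr0 addr0 /powR eqxx.
  by case: (s == 0).
Qed.

(** Jensen's inequality, by integrating the tangent line of the power at the
    average. *)
Lemma avg_powR_le s g J : measurable_fun setT (g : measurableTypeR R -> R) ->
  0 <= s <= 1 -> dyadic_integrable g -> {ae mu, forall x, 0 < g x} ->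
  avg (fun x => g x `^ s) J <= avg g J `^ s.
Proof.
move=> mg s01 gi g0; have a0 := avg_gt0 (gi J) g0; set a := avg g J in a0 *.
have [i e] := avg_affine (a `^ s * (1 - s)) (a `^ s * (s / a)) (gi J).
apply: (@le_trans _ _ (avg (fun x => a `^ s * (1 - s) + a `^ s * (s / a) * g x) J)).
  apply: avg_le_ae => //; first exact: dyadic_integrable_powR.
  apply: (ae_imp _ g0) => x gx.
  have gE : g x = a * (g x / a) by rewrite mulrC divfK// gt_eqF.
  rewrite {1}gE powRM ?(ltW a0)// ?(ltW (divr_gt0 gx a0))//.
  have := powR_le_tangent (divr_gt0 gx a0) s01.
  move=> /(ler_wpM2l (powR_ge0 a s)) /le_trans; apply.
  rewrite le_eqVlt; apply/orP; left; apply/eqP; field; exact: lt0r_neq0.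
rewrite e -/a le_eqVlt; apply/orP; left; apply/eqP; field; exact: lt0r_neq0.
Qed.

Lemma dyadic_integrable_ln s g : measurable_fun setT (g : measurableTypeR R -> R) ->
  0 < s -> dyadic_integrable g ->
  dyadic_integrable (fun x => g x `^ (- s)) -> dyadic_integrable (fun x => ln (g x)).
Proof.
move=> mg s0 gi ui J; have mJ := measurable_dset (R := R) J.
have i1 := integrable_add mJ (integrable_norm (gi J)) (integrable_scale s^-1 mJ (ui J)).
apply: le_integrable i1 => //.
  by apply/measurable_EFinP; apply: measurable_funTS; exact: measurableT_comp.
have h4 x : 0 <= s^-1 * g x `^ (- s) by rewrite mulr_ge0 ?powR_ge0// invr_ge0 ltW.
move=> x _; rewrite /= lee_fin [leRHS]ger0_norm ?addr_ge0//.
have [gx|gx] := leP (g x) 0; first by rewrite ln0// normr0 addr_ge0.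
have h1 := ln_sublinear gx.
have h2 := ln_sublinear (powR_gt0 (- s) gx).
have h3 : - ln (g x) <= s^-1 * g x `^ (- s).
  by rewrite ln_powR mulNr -mulrN in h2; rewrite mulrC ler_pdivlMr// mulrC ltW.
rewrite (gtr0_norm gx) ler_norml; have := h4 x; lra.
Qed.

End Averages.

(** * Weights and their characteristics *)

Section Weights.
Context {R : realType}.
Notation mu := (@lebesgue_measure R).
Implicit Types (f g h u v w : R -> R) (I J L : dyadic) (q s t : R).

Lemma weight_measurable w : weight w ->
  measurable_fun setT (w : measurableTypeR R -> R).
Proof. by case=> -[]. Qed.

Lemma weight_dyadic_integrable w : weight w -> dyadic_integrable w.
Proof.
move=> [[mw _ hw] _] J; have mJ := measurable_dset (R := R) J.
pose K : set R := `[J.2%:~R * dlen J, (J.2 + 1)%:~R * dlen J]%classic.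
have cK : compact K by exact: segment_compact.
apply/integrableP; split; first by apply/measurable_EFinP; exact: measurable_funTS.
apply: le_lt_trans (hw K (@subsetT _ K) cK).
apply: ge0_subset_integral => //.
- exact: compact_measurable.
- by apply/measurable_EFinP; apply: measurableT_comp => //; exact: measurable_funTS.
- by move=> x; rewrite /dset /K /= !in_itv /= => /andP[-> /ltW ->].
Qed.

Lemma dlen_top_right j : dlen (top_right j) = 2 ^+ j :> R.
Proof. by rewrite /dlen /= opprK. Qed.

(** A compact set is covered by two dyadic intervals, one on each side of 0. *)
Lemma weightP v : measurable_fun setT (v : measurableTypeR R -> R) ->
  dyadic_integrable v -> {ae mu, forall x, 0 < v x} -> weight v.
Proof.
move=> mv vi v0; split=> //; split=> //; first exact: openT.
move=> K _ cK.
have [M [_ HM]] := compact_bounded cK.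
pose M1 := `|M| + 1.
have KM x : K x -> `|x| <= M1 by apply: HM; rewrite /M1 ltr_pwDr// ler_norm.
have [j hj] : exists j : nat, M1 < 2 ^+ j.
  have [j hj] : exists j : nat, M1 < j%:R.
    exists (Num.truncn M1).+1; exact: truncnS_gt.
  by exists j; rewrite (lt_trans hj)// -natrX ltr_nat ltn_expl.
pose T := dset (top_left j) `|` dset (top_right j) : set (measurableTypeR R).
have mT : measurable T by apply: measurableU; exact: measurable_dset.
have KT : K `<=` T.
  move=> x /KM; rewrite ler_norml => /andP[x1 x2]; rewrite /T.
  have E : dlen (top_left j) = 2 ^+ j :> R := dlen_top_right j.
  have [x0|x0] := ltP x 0; [left|right]; rewrite /dset /= in_itv /=.
    rewrite E mulN1r.
    have -> : (-1 + 1)%:~R * 2 ^+ j = 0 :> R by rewrite addNr mul0r.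
    by rewrite x0 andbT; lra.
  by rewrite dlen_top_right mul0r x0 /= add0r mul1r; lra.
have iT : mu.-integrable T (EFin \o v).
  apply/integrableP; split; first by apply/measurable_EFinP; exact: measurable_funTS.
  rewrite ge0_integral_setU//=.
  - have /integrableP[_ fin_left] := vi (top_left j).
    have /integrableP[_ fin_right] := vi (top_right j).
    exact: lte_add_pinfty.
  - exact: measurable_dset.
  - exact: measurable_dset.
  - by apply/measurable_EFinP; apply: measurableT_comp => //; exact: measurable_funTS.
  - exact: disjoint_tops.
have := integrable_lty mT (integrable_norm iT).
apply: le_lt_trans; apply: ge0_subset_integral => //.
- exact: compact_measurable.
- by apply/measurable_EFinP; apply: measurableT_comp => //; exact: measurable_funTS.
Qed.

Lemma mean_lty_integrable h J : measurable_fun setT (h : measurableTypeR R -> R) ->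
  (forall x, 0 <= h x) -> (mean h J < +oo)%E -> mu.-integrable (dset J) (EFin \o h).
Proof.
move=> mh h0 hJ; apply/integrableP; split.
  by apply/measurable_EFinP; exact: measurable_funTS.
have -> : (\int[mu]_(x in dset J) `|(EFin \o h) x|)%E =
    ((dlen J)%:E * mean h J)%E.
  rewrite /mean muleA -EFinM divff ?gt_eqF ?dlen_gt0// mul1e.
  by apply: eq_integral => x _; rewrite /= ger0_norm.
by apply: lte_mul_pinfty => //; rewrite lee_fin ltW ?dlen_gt0.
Qed.

Definition dual_weight q v x : R := v x `^ (- (q - 1)^-1).

(** The geometric mean of v lies between the reciprocal of the factor of the dual
    weight in the A^d_q condition and the average of v.  Hence A^d_q implies the
    limiting condition q = oo with the same constant. *)
Lemma geometric_mean_dual q v J : 1 < q ->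
  measurable_fun setT (v : measurableTypeR R -> R) ->
  {ae mu, forall x, 0 < v x} -> dyadic_integrable v ->
  dyadic_integrable (dual_weight q v) ->
  [/\ dyadic_integrable (fun x => ln (v x)),
      avg (fun x => ln (v x)) J <= ln (avg v J) &
      - ((q - 1) * ln (avg (dual_weight q v) J)) <= avg (fun x => ln (v x)) J].
Proof.
move=> q1 mv vp vi ui; have q0 : 0 < q - 1 by lra.
have li : dyadic_integrable (fun x => ln (v x)).
  by apply: (dyadic_integrable_ln mv _ vi ui); rewrite invr_gt0.
split => //; first exact: avg_ln_le.
have up : {ae mu, forall x, 0 < dual_weight q v x}.
  by apply: (ae_imp _ vp) => x; exact: powR_gt0.
have [ai ae] := avg_affine 0 (- (q - 1)^-1) (li J).
have E : (fun x => ln (dual_weight q v x)) = fun x => 0 + - (q - 1)^-1 * ln (v x).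
  by apply/funext => x; rewrite ln_powR add0r.
have := avg_ln_le (ui J) _ up; rewrite E ae add0r => /(_ ai).
move=> /(ler_wpM2l (ltW q0)); rewrite mulNr mulrN mulrA divff ?gt_eqF// mul1r.
lra.
Qed.

(** That Q >= 1 is the comparison of both factors with the geometric mean of v. *)
Lemma Ad_char_fin q v : 1 < q -> weight v ->
  (Ad_char q v < +oo)%E ->
  dyadic_integrable (dual_weight q v) /\
  exists Q : R, [/\ 1 <= Q, Ad_char q v = Q%:E &
    forall J, avg v J * avg (dual_weight q v) J `^ (q - 1) <= Q].
Proof.
move=> q1 wv fin; have q0 : 0 < q - 1 by lra.
have mv := weight_measurable wv; have vi := weight_dyadic_integrable wv.
have vp := wv.2.
have av J : 0 < avg v J by exact: avg_gt0.
have le J : (mean v J * mean (dual_weight q v) J `^ (q - 1) <= Ad_char q v)%E.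
  by apply: ereal_sup_ubound; exists J.
have ui : dyadic_integrable (dual_weight q v).
  move=> J; apply: mean_lty_integrable.
  - exact: measurable_powR_fun.
  - by move=> x; exact: powR_ge0.
  - apply: (@lty_poweRy _ _ (q - 1)); first exact: lt0r_neq0.
    rewrite ltey; apply/eqP => E; have := le J.
    by rewrite E meanE// gt0_muley ?lte_fin// leye_eq => /eqP E2; rewrite E2 ltxx in fin.
have le' J : ((avg v J * avg (dual_weight q v) J `^ (q - 1))%:E <= Ad_char q v)%E.
  by have := le J; rewrite !meanE// poweR_EFin -EFinM.
have up : {ae mu, forall x, 0 < dual_weight q v x}.
  by apply: (ae_imp _ vp) => x; exact: powR_gt0.
split=> //; have := le' (0, 0); case E : (Ad_char q v) => [Q| |] // leQ; last first.
  by rewrite E in fin.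
rewrite lee_fin in leQ.
exists Q; split=> //; last by move=> J; have := le' J; rewrite E.
apply: le_trans leQ.
have au : 0 < avg (dual_weight q v) (0, 0) by exact: avg_gt0.
have [_ h1 h2] := geometric_mean_dual (0, 0) q1 mv vp vi ui.
have p0 : 0 < avg (dual_weight q v) (0, 0) `^ (q - 1) by exact: powR_gt0.
have a0 := av (0, 0).
rewrite -ler_ln ?posrE//; last by rewrite mulr_gt0.
by rewrite ln1 lnM ?posrE// ln_powR; lra.
Qed.

Lemma Ad_char_le q v (Q : R) : dyadic_integrable v ->
  dyadic_integrable (dual_weight q v) ->
  (forall J, avg v J * avg (dual_weight q v) J `^ (q - 1) <= Q) ->
  (Ad_char q v <= Q%:E)%E.
Proof.
move=> vi ui h; apply: ge_ereal_sup => _ [J _ <-].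
by rewrite !meanE// poweR_EFin -EFinM lee_fin; exact: h.
Qed.

Lemma Cd_char_fin s w : weight w -> (Cd_char s w < +oo)%E ->
  dyadic_integrable (fun x => w x `^ s) /\
  exists C : R, [/\ 0 < C, Cd_char s w = C%:E &
    forall J, avg (fun x => w x `^ s) J <= C * avg w J `^ s].
Proof.
move=> ww fin; have mw := weight_measurable ww.
have wi := weight_dyadic_integrable ww; have wp := ww.2.
have aw J : 0 < avg w J by exact: avg_gt0.
have le J : (mean (fun x => (w x `^ s)%R) J * mean w J `^ (- s) <= Cd_char s w)%E.
  by apply: ereal_sup_ubound; exists J.
have vi : dyadic_integrable (fun x => w x `^ s).
  move=> J; apply: mean_lty_integrable.
  - exact: measurable_powR_fun.
  - by move=> x; exact: powR_ge0.
  - rewrite ltey; apply/eqP => E; have := le J.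
    rewrite E meanE// poweR_EFin gt0_mulye ?lte_fin ?powR_gt0// leye_eq => /eqP E2.
    by rewrite E2 ltxx in fin.
split=> //.
have vp : {ae mu, forall x, 0 < (w x `^ s)%R}.
  by apply: (ae_imp _ wp) => x; exact: powR_gt0.
have le' J : ((avg (fun x => w x `^ s) J * avg w J `^ (- s))%:E <= Cd_char s w)%E.
  by have := le J; rewrite !meanE// poweR_EFin -EFinM.
have := le' (0, 0); case E : (Cd_char s w) => [C| |] // leC; last first.
  by rewrite E in fin.
rewrite lee_fin in leC.
exists C; split=> //.
  by apply: lt_le_trans leC; rewrite mulr_gt0 ?powR_gt0//; exact: avg_gt0.
move=> J; have := le' J; rewrite E lee_fin powRN ler_pdivrMr ?powR_gt0//.
Qed.

Lemma jump_dint v K : dyadic_integrable v -> 0 < avg v K ->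
  jump (dint v) K ^+ 2 / dint v K = dlen K * (jump (avg v) K ^+ 2 / (4 * avg v K)).
Proof.
move=> vi a0; rewrite /jump !dint_avg dlen_left dlen_right.
by field; rewrite !gt_eqF ?dlen_gt0.
Qed.

(** The comparison sequence consists of the geometric means of v, whose logarithms
    form a martingale. *)
Lemma carleson_Ad q v (Q : R) J N : 1 < q ->
  measurable_fun setT (v : measurableTypeR R -> R) ->
  {ae mu, forall x, 0 < v x} -> dyadic_integrable v ->
  dyadic_integrable (dual_weight q v) -> 1 <= Q ->
  (forall J, avg v J * avg (dual_weight q v) J `^ (q - 1) <= Q) ->
  treesum (fun K => jump (dint v) K ^+ 2 / dint v K) J N <= 136 * Q * dint v J.
Proof.
move=> q1 mv vp vi ui Q1 hQ; have av K : 0 < avg v K by exact: avg_gt0.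
have up : {ae mu, forall x, 0 < dual_weight q v x}.
  by apply: (ae_imp _ vp) => x; exact: powR_gt0.
have au K : 0 < avg (dual_weight q v) K by exact: avg_gt0.
have [li _ _] := geometric_mean_dual J q1 mv vp vi ui.
pose y K := avg (fun x => ln (v x)) K.
have ym K : y K = (y (dleft K) + y (dright K)) / 2 by exact: avg_midpoint.
rewrite dint_avg.
apply: le_trans (buckley (x := avg v) (z := fun K => expR (y K))
  (b := fun K => jump y K / 2) (Q := Q) J N Q1 _ _ _ _ _ _).
- by apply: treesum_le => K; rewrite jump_dint.
- by move=> K; exact: avg_midpoint.
- move=> K; rewrite expR_gt0 /= -[leRHS]lnK ?posrE// ler_expR.
  by have [] := geometric_mean_dual K q1 mv vp vi ui.
- move=> K; have [_ _ h] := geometric_mean_dual K q1 mv vp vi ui.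
  apply: le_trans (_ : Q * expR (- ((q - 1) * ln (avg (dual_weight q v) K))) <= _).
    have := hQ K; rewrite /powR gt_eqF// expRN.
    by rewrite ler_pdivlMr ?expR_gt0.
  by rewrite ler_wpM2l ?ler_expR//; lra.
- by move=> K; rewrite !expRK /jump [X in _ <= X + _](ym K); lra.
- by move=> K; rewrite !expRK /jump [X in _ <= X - _](ym K); lra.
- move=> K; set b := jump y K / 2.
  have -> : y (dleft K) = y K + - b by rewrite /b /jump (ym K); field.
  have -> : y (dright K) = y K + b by rewrite /b /jump (ym K); field.
  rewrite !expRD -mulrDr -mulrA ler_wpM2l ?expR_ge0//.
  by rewrite [expR (- b) + _]addrC; exact: cosh_ge.
Qed.

(** The comparison sequence is (m_J w)^s, which is at most m_J (w^s) by Jensen's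
    inequality and at least m_J (w^s) / C by hypothesis. *)
Lemma carleson_Cd s w (C : R) J N : 2 <= s -> weight w ->
  dyadic_integrable (fun x => w x `^ s) ->
  (forall J, avg (fun x => w x `^ s) J <= C * avg w J `^ s) ->
  1 <= C /\
  treesum (fun K => jump (dint (fun x => w x `^ s)) K ^+ 2 /
    dint (fun x => w x `^ s) K) J N <= 136 * C * dint (fun x => w x `^ s) J.
Proof.
move=> s2 ww vi hC; set v := fun x => w x `^ s.
have s0 : 0 < s by lra.
have mw := weight_measurable ww; have wi := weight_dyadic_integrable ww.
have wp := ww.2; have mv := measurable_powR_fun s mw.
have vp : {ae mu, forall x, 0 < v x}.
  by apply: (ae_imp _ wp) => x; exact: powR_gt0.
have aw K : 0 < avg w K by exact: avg_gt0.
have av K : 0 < avg v K by exact: avg_gt0.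
have zx K : avg w K `^ s <= avg v K.
  have s1 : 0 <= s^-1 <= 1 by rewrite invr_ge0 (ltW s0) invf_le1//; lra.
  have := avg_powR_le K mv s1 vi vp.
  have -> : avg (fun x => v x `^ s^-1) K = avg w K.
    apply: EFin_inj; rewrite -!meanE//; last exact: dyadic_integrable_powR.
    apply: mean_ae_eq => //; first exact: measurable_powR_fun.
    by apply: (ae_imp _ wp) => x wx; rewrite /v -powRrM divff ?gt_eqF// powRr1// ltW.
  move=> /(ge0_ler_powR (ltW s0)); rewrite !nnegrE powR_ge0 ltW// => /(_ isT isT).
  by rewrite -powRrM mulVf ?gt_eqF// powRr1// ltW.
have C1 : 1 <= C.
  have := le_trans (zx (0, 0)) (hC (0, 0)).
  have p0 : 0 < avg w (0, 0) `^ s by exact: powR_gt0.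
  by rewrite -[X in X <= _]mul1r ler_pM2r.
split=> //; rewrite dint_avg.
pose c K := jump (avg w) K / 2 / avg w K.
have awm K : avg w K = (avg w (dleft K) + avg w (dright K)) / 2 by exact: avg_midpoint.
have cr K : avg w (dright K) = avg w K * (1 + c K).
  rewrite /c (_ : _ * _ = avg w K + jump (avg w) K / 2); last first.
    by field; exact: lt0r_neq0.
  by rewrite (awm K) /jump; field.
have cl K : avg w (dleft K) = avg w K * (1 - c K).
  rewrite /c (_ : _ * _ = avg w K - jump (avg w) K / 2); last first.
    by field; exact: lt0r_neq0.
  by rewrite (awm K) /jump; field.
have cK K : 0 < 1 + c K /\ 0 < 1 - c K.
  by have := aw (dright K); have := aw (dleft K); rewrite cr cl !(pmulr_rgt0 _ (aw K)).
apply: le_trans (buckley (x := avg v) (z := fun K => avg w K `^ s)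
  (b := fun K => s * c K) (Q := C) J N C1 _ _ _ _ _ _).
- by apply: treesum_le => K; rewrite jump_dint.
- by move=> K; exact: avg_midpoint.
- by move=> K; rewrite powR_gt0//= zx.
- by [].
- move=> K; have [c1 c2] := cK K; rewrite !ln_powR cr lnM ?posrE//.
  have := ln_le_sub1 c1 => /(ler_wpM2l (ltW s0)); lra.
- move=> K; have [c1 c2] := cK K; rewrite !ln_powR cl lnM ?posrE//.
  have := ln_le_sub1 c2 => /(ler_wpM2l (ltW s0)); lra.
- move=> K; have [c1 c2] := cK K; rewrite cr cl.
  rewrite (powRM _ (ltW (aw K)) (ltW c1)) (powRM _ (ltW (aw K)) (ltW c2)).
  rewrite -mulrDr -mulrA.
  rewrite ler_wpM2l ?powR_ge0// [_ + (1 + c K) `^ s]addrC.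
  by apply: powR_midpoint => //; lra.
Qed.

End Weights.

(** * Powers of Muckenhoupt weights *)

Section PowerWeights.
Context {R : realType}.
Notation mu := (@lebesgue_measure R).
Implicit Types (f g h u v w : R -> R) (I J L : dyadic) (q s t : R).

Lemma mul_powR_le (a b a' b' s r Q : R) : 0 <= s -> 0 <= r -> 0 < a -> 0 <= a' ->
  0 <= b' -> a' <= a `^ s -> b' <= b `^ s -> a * b `^ r <= Q ->
  a' * b' `^ r <= Q `^ s.
Proof.
move=> s0 r0 a0 a'0 b'0 ha hb hQ.
have ab0 : 0 <= a * b `^ r by rewrite mulr_ge0 ?powR_ge0 ?(ltW a0).
apply: (@le_trans _ _ ((a * b `^ r) `^ s)).
  rewrite powRM ?(ltW a0) ?powR_ge0// powRAC.
  apply: ler_pM ha _ => //; rewrite ?powR_ge0//.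
  by apply: ge0_ler_powR hb => //; rewrite nnegrE powR_ge0.
by apply: (ge0_ler_powR s0 _ _ hQ); rewrite ?nnegrE//; exact: le_trans ab0 hQ.
Qed.

Lemma weight_avg_gt0 w J : weight w -> 0 < avg w J.
Proof. by move=> ww; apply: avg_gt0; [exact: weight_dyadic_integrable|exact: ww.2]. Qed.

Lemma weight_powR s w : weight w -> dyadic_integrable (fun x => w x `^ s) ->
  weight (fun x => w x `^ s).
Proof.
move=> ww vi; apply: weightP => //.
  exact: measurable_powR_fun (weight_measurable ww).
by apply: (ae_imp _ ww.2) => x; exact: powR_gt0.
Qed.

Lemma avg_dual_weight_gt0 q v J : weight v -> dyadic_integrable (dual_weight q v) ->
  0 < avg (dual_weight q v) J.
Proof.
move=> wv ui; apply: avg_gt0 => //.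
by apply: (ae_imp _ wv.2) => x; exact: powR_gt0.
Qed.

(** Jensen's inequality for w and for its dual weight. *)
Lemma in_Ad_powR_le1 s q w : 0 <= s <= 1 -> 1 < q -> in_Ad q w ->
  in_Ad q (fun x => w x `^ s) /\
  (Ad_char q (fun x => (w x `^ s)%R) <= Ad_char q w `^ s)%E.
Proof.
move=> s01 q1 [ww fin]; have [ui [Q [Q1 -> hQ]]] := Ad_char_fin q1 ww fin.
have mw := weight_measurable ww; have wi := weight_dyadic_integrable ww.
have vi := dyadic_integrable_powR mw s01 wi.
have [s0 s1] := andP s01; have q0 : 0 <= q - 1 by lra.
have mu' := measurable_powR_fun (- (q - 1)^-1) mw.
have up : {ae mu, forall x, 0 < dual_weight q w x}.
  by apply: (ae_imp _ ww.2) => x; exact: powR_gt0.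
have dE : dual_weight q (fun x => w x `^ s) = fun x => dual_weight q w x `^ s.
  by apply/funext => x; rewrite /dual_weight powRAC.
have uvi : dyadic_integrable (dual_weight q (fun x => w x `^ s)).
  by rewrite dE; exact: dyadic_integrable_powR.
have le : (Ad_char q (fun x => (w x `^ s)%R) <= (Q `^ s)%:E)%E.
  apply: (Ad_char_le vi uvi) => J; rewrite dE.
  have uvp : {ae mu, forall x, 0 < (dual_weight q w x `^ s)%R}.
    by apply: (ae_imp _ up) => x; exact: powR_gt0.
  rewrite dE in uvi.
  exact: (mul_powR_le s0 q0 (weight_avg_gt0 J ww)
    (ltW (weight_avg_gt0 J (weight_powR ww vi))) (ltW (avg_gt0 (uvi J) uvp))
    (avg_powR_le J mw s01 wi ww.2) (avg_powR_le J mu' s01 ui up) (hQ J)).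
split; last by rewrite poweR_EFin.
by split; [exact: weight_powR|exact: le_lt_trans le (ltry _)].
Qed.

(** The exponent q = s (p - 1) + 1 is the one for which w^s and w have the same
    dual weights, with respect to q and to p. *)
Lemma in_Ad_powR_ge1 s p w : 1 <= s -> 1 < p -> in_Cd s w -> in_Ad p w ->
  in_Ad (s * (p - 1) + 1) (fun x => w x `^ s) /\
  (Ad_char (s * (p - 1) + 1) (fun x => (w x `^ s)%R) <=
     Cd_char s w * Ad_char p w `^ s)%E.
Proof.
move=> s1 p1 [ww Cfin] [_ fin]; have [ui [Q [Q1 -> hQ]]] := Ad_char_fin p1 ww fin.
have [vi [C [C0 -> hC]]] := Cd_char_fin ww Cfin.
have s0 : 0 < s by lra.
have p0 : 0 < p - 1 by lra.
set q := s * (p - 1) + 1.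
have qE : q - 1 = s * (p - 1) by rewrite /q; ring.
have dE : dual_weight q (fun x => w x `^ s) = dual_weight p w.
  apply/funext => x; rewrite /dual_weight -powRrM qE; congr (_ `^ _).
  by field; rewrite !gt_eqF.
have le : (Ad_char q (fun x => (w x `^ s)%R) <= (C * Q `^ s)%:E)%E.
  apply: Ad_char_le => //; first by rewrite dE.
  move=> J; rewrite dE qE.
  have aw := weight_avg_gt0 J ww; have au := avg_dual_weight_gt0 J ww ui.
  apply: (@le_trans _ _ (C * (avg w J * avg (dual_weight p w) J `^ (p - 1)) `^ s)).
    rewrite powRM ?(ltW aw) ?powR_ge0// mulrC mulrA -powRrM [(p - 1) * s]mulrC.
    by rewrite mulrC ler_wpM2r ?powR_ge0.
  rewrite ler_wpM2l ?(ltW C0)//.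
  apply: ge0_ler_powR (hQ J); rewrite ?nnegrE ?(ltW s0)//; last by lra.
  by rewrite mulr_ge0 ?powR_ge0 ?(ltW aw).
split; last by rewrite poweR_EFin -EFinM.
by split; [exact: weight_powR|exact: le_lt_trans le (ltry _)].
Qed.

(** For q = 1 - s the dual weight of w^s is w almost everywhere, so the two
    characteristics are suprema of the same quantities. *)
Lemma in_Ad_powR_lt0 s w : s < 0 -> in_Cd s w ->
  in_Ad (1 - s) (fun x => w x `^ s) /\
  (Ad_char (1 - s) (fun x => (w x `^ s)%R) <= Cd_char s w)%E.
Proof.
move=> s0 [ww Cfin]; have [vi [C [C0 -> hC]]] := Cd_char_fin ww Cfin.
have wi := weight_dyadic_integrable ww; have mw := weight_measurable ww.
have mv := measurable_powR_fun s mw.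
have qE : 1 - s - 1 = - s by ring.
have dw : {ae mu, forall x, w x = dual_weight (1 - s) (fun x => w x `^ s) x}.
  apply: (ae_imp _ ww.2) => x wx; rewrite /dual_weight -powRrM qE invrN opprK.
  by rewrite divff ?lt_eqF// powRr1// ltW.
have mdw := measurable_powR_fun (- (1 - s - 1)^-1) mv.
have mean_dw J : mean (dual_weight (1 - s) (fun x => w x `^ s)) J = (avg w J)%:E.
  by rewrite -meanE//; apply/esym; exact: mean_ae_eq.
have ui : dyadic_integrable (dual_weight (1 - s) (fun x => w x `^ s)).
  move=> J; apply: mean_lty_integrable => //; first by move=> x; exact: powR_ge0.
  by rewrite mean_dw ltry.
have le : (Ad_char (1 - s) (fun x => (w x `^ s)%R) <= C%:E)%E.
  apply: Ad_char_le => // J; have aw := weight_avg_gt0 J ww.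
  have -> : avg (dual_weight (1 - s) (fun x => w x `^ s)) J = avg w J.
    by apply: EFin_inj; rewrite -meanE.
  by rewrite qE powRN ler_pdivrMr ?powR_gt0.
split=> //; split; [exact: weight_powR|exact: le_lt_trans le (ltry _)].
Qed.

(** * Norm estimates *)

Lemma constant_bound m n (C Q : R) : 0 < C -> 1 <= Q ->
  Num.sqrt ((2 * n.+1%:R + 8 * (136 * Q)) * m.+1%:R * C) <=
  34 * (m + n + 2)%:R ^+ 3 * (C `^ 2^-1 * Q `^ 2^-1).
Proof.
move=> C0 Q1; have Q0 : 0 <= Q by lra.
rewrite !powR12_sqrt ?(ltW C0)// -sqrtrM ?(ltW C0)//.
set X := (m + n + 2)%:R : R.
have XE : X = m.+1%:R + n.+1%:R by rewrite -natrD; congr _%:R; lia.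
have a1 : (1 : R) <= m.+1%:R by rewrite ler1n.
have b1 : (1 : R) <= n.+1%:R by rewrite ler1n.
set a := m.+1%:R in XE a1 *; set b := n.+1%:R in XE b1 *.
have X2 : 2 <= X by lra.
have X3 : X <= X ^+ 3.
  by rewrite exprS ler_peMr; [|lra|rewrite exprn_ege1//; lra].
have CQ : 0 <= C * Q by rewrite mulr_ge0// ltW.
apply: (@le_trans _ _ (34 * X * Num.sqrt (C * Q))); last first.
  by rewrite ler_wpM2r ?sqrtr_ge0// ler_wpM2l.
have -> : 34 * X = Num.sqrt ((34 * X) ^+ 2).
  by rewrite sqrtr_sqr ger0_norm//; lra.
rewrite -sqrtrM ?sqr_ge0//; apply: ler_wsqrtr.
(* 2 + 8 * 136 = 1090, which is less than 34^2. *)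
have h1 : (2 * b + 8 * (136 * Q)) * a <= 1090 * (a * b) * Q.
  have h : 2 * b + 8 * (136 * Q) <= 1090 * b * Q by nra.
  by have := ler_wpM2r (_ : 0 <= a) h; lra.
have h2 : a * b <= X ^+ 2 by rewrite XE; nra.
have h3 := ler_wpM2r (ltW C0) h1.
apply: le_trans h3 _.
have h4 := ler_wpM2r CQ h2; nra.
Qed.

Lemma poweR_half_le (a b : \bar R) t : (0 <= a)%E -> (a <= b `^ (2 * t)%R)%E ->
  (a `^ 2^-1 <= b `^ t)%E.
Proof.
move=> a0 ab; rewrite (_ : t = 2 * t * 2^-1); last by field.
rewrite poweRrM; apply: gt0_ler_poweR => //; rewrite in_itv/= leey andbT//.
exact: poweR_ge0.
Qed.

Lemma powR_half_mul_le (C Q D : R) : 0 <= C -> 0 <= Q -> 0 <= D ->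
  C * Q <= D ^+ 2 -> C `^ 2^-1 * Q `^ 2^-1 <= D.
Proof.
move=> C0 Q0 D0 h; rewrite !powR12_sqrt// -sqrtrM//.
by rewrite -[leRHS](ger0_norm D0) -sqrtr_sqr ler_wsqrtr.
Qed.

Lemma tHaar_estimate t m n w (C Q : R) : let v := fun x => w x `^ (2 * t) in
  weight w -> dyadic_integrable v -> 0 < C -> 1 <= Q ->
  (forall J, avg v J <= C * avg w J `^ (2 * t)) ->
  (forall J N, treesum (fun K => jump (dint v) K ^+ 2 / dint v K) J N <=
     136 * Q * dint v J) ->
  (forall f, L2 f -> exists g, tHaar t m n w f g) /\
  forall f g, L2 f -> tHaar t m n w f g ->
    (L2norm g <= (34 * (m + n + 2)%:R ^+ 3 * (C `^ 2^-1 * Q `^ 2^-1))%:E * L2norm f)%E.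
Proof.
move=> v ww vi C0 Q1 hC hB; have mw := weight_measurable ww.
have wi := weight_dyadic_integrable ww.
have dv0 J : 0 < dint v J.
  rewrite dint_avg mulr_gt0 ?dlen_gt0//.
  by apply: weight_avg_gt0; exact: weight_powR.
have mE L : fine (mean w L) = avg w L by rewrite meanE.
have m0 L : 0 < fine (mean w L) by rewrite mE weight_avg_gt0.
have hC' L : dint v L / dlen L <= C * fine (mean w L) `^ (2 * t).
  by rewrite mE; exact: hC.
have B0 : 0 < 136 * Q by lra.
split=> [f fL2|f g fL2 fg].
  exact: (tHaar_exists m n mw vi dv0 C0 B0 m0 hC' hB fL2).
apply: le_trans (tHaar_bound mw vi dv0 C0 B0 m0 hC' hB fL2 fg) _.
apply: lee_wpmul2r; first exact: Lnorm_ge0.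
by rewrite lee_fin; exact: constant_bound.
Qed.

Lemma tHaar_estimate_Ad t m n w q (C Q : R) : let v := fun x => w x `^ (2 * t) in
  weight w -> 1 < q -> in_Ad q v -> Ad_char q v = Q%:E -> 0 < C ->
  (forall J, avg v J <= C * avg w J `^ (2 * t)) ->
  1 <= Q /\
  (forall f, L2 f -> exists g, tHaar t m n w f g) /\
  forall f g, L2 f -> tHaar t m n w f g ->
    (L2norm g <= (34 * (m + n + 2)%:R ^+ 3 * (C `^ 2^-1 * Q `^ 2^-1))%:E * L2norm f)%E.
Proof.
move=> v ww q1 [wv fin] QE C0 hC; have vi := weight_dyadic_integrable wv.
have [ui [Q' [Q1 QE' hQ]]] := Ad_char_fin q1 wv fin.
have QQ : Q' = Q by apply: EFin_inj; rewrite -QE' -QE.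
rewrite QQ in Q1 hQ; split => //; apply: tHaar_estimate => // J N.
by apply: (carleson_Ad J N q1 _ wv.2 vi ui Q1 hQ); exact: weight_measurable.
Qed.

End PowerWeights.

Theorem theorem1p2 (R : realType) :
  exists (Cq Cp : R -> R) (C : R),
    (forall q, 1 < q -> 0 < Cq q) /\ (forall p, 1 < p -> 0 < Cp p) /\ 0 < C /\
  forall (t : R) (m n : nat) (w : R -> R),
    in_Cd (2 * t) w -> in_Ad_infty w ->
    let v := fun x => w x `^ (2 * t) in
    let cplx : R := (m + n + 2)%:R ^+ 3 in
    (forall f, L2 f -> exists g, tHaar t m n w f g) /\
    (0 <= 2 * t < 1 ->
       (exists q, 1 < q /\ in_Ad q w) /\
       forall q, 1 < q -> in_Ad q w ->
         in_Ad q v /\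
         forall f g, L2 f -> tHaar t m n w f g ->
           (L2norm g <= (Cq q * cplx)%:E * Ad_char q v `^ 2^-1 * L2norm f)%E /\
           ((Cq q * cplx)%:E * Ad_char q v `^ 2^-1 * L2norm f
              <= (Cq q * cplx)%:E * Ad_char q w `^ t * L2norm f)%E) /\
    (1 <= 2 * t ->
       forall p, 1 < p -> in_Ad p w ->
         let q := 2 * t * (p - 1) + 1 in
         in_Ad q v /\
         forall f g, L2 f -> tHaar t m n w f g ->
           let bound_q := ((Cq q * cplx)%:E * Cd_char (2 * t) w `^ 2^-1 *
                             Ad_char q v `^ 2^-1 * L2norm f)%E in
           let bound_p := ((Cp p * cplx)%:E * Cd_char (2 * t) w *
                             Ad_char p w * L2norm f)%E in
           (L2norm g <= bound_q)%E /\ (L2norm g <= bound_p)%E /\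
           (t <= 1 -> (bound_q <= bound_p)%E)) /\
    (t < 0 ->
       in_Ad (1 - 2 * t) v /\
       forall f g, L2 f -> tHaar t m n w f g ->
         (L2norm g <= (C * cplx)%:E * Cd_char (2 * t) w * L2norm f)%E).
Proof.
exists (fun=> 34), (fun=> 34), 34; split; first by [].
split; first by []; split; first by [].
move=> t m n w wC wA v cplx.
have [ww Cfin] := wC; have [vi [C [C0 CE hC]]] := Cd_char_fin ww Cfin.
have cplx0 : 0 <= 34 * cplx by rewrite mulr_ge0// exprn_ge0.
have N0 f : (0 <= L2norm f)%E := Lnorm_ge0 _ _ _.
have [q0 [q01 wAq0]] := wA.
split.
  have [t0|t0] := ltP t 0.
    have s0 : 2 * t < 0 by lra.
    have [vA le] := in_Ad_powR_lt0 s0 wC.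
    have q1 : 1 < 1 - 2 * t by lra.
    have [_ [Q [_ QE _]]] := Ad_char_fin q1 vA.1 vA.2.
    exact: (tHaar_estimate_Ad m n ww q1 vA QE C0 hC).2.1.
  have [t1|t1] := ltP (2 * t) 1.
    have s01 : 0 <= 2 * t <= 1 by lra.
    have [vA _] := in_Ad_powR_le1 s01 q01 wAq0.
    have [_ [Q [_ QE _]]] := Ad_char_fin q01 vA.1 vA.2.
    exact: (tHaar_estimate_Ad m n ww q01 vA QE C0 hC).2.1.
  have [vA _] := in_Ad_powR_ge1 t1 q01 wC wAq0.
  have q1 : 1 < 2 * t * (q0 - 1) + 1 by nra.
  have [_ [Q [_ QE _]]] := Ad_char_fin q1 vA.1 vA.2.
  exact: (tHaar_estimate_Ad m n ww q1 vA QE C0 hC).2.1.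
split.
  move=> /andP[t0 t1]; split; first by exists q0.
  move=> q q1 wAq; have s01 : 0 <= 2 * t <= 1 by lra.
  have [vA le] := in_Ad_powR_le1 s01 q1 wAq; split => // f g fL2 fg.
  have [_ [Q [Q1 QE _]]] := Ad_char_fin q1 vA.1 vA.2.
  have hC1 J : avg v J <= 1 * avg w J `^ (2 * t).
    rewrite mul1r; apply: avg_powR_le => //; last exact: ww.2.
    - exact: weight_measurable.
    - exact: weight_dyadic_integrable.
  have [_ [_ /(_ f g fL2 fg)]] := tHaar_estimate_Ad m n ww q1 vA QE ltr01 hC1.
  rewrite powR1 mul1r => bound; split.
    by rewrite QE poweR_EFin -EFinM.
  apply: lee_wpmul2r; first exact: N0.
  apply: lee_wpmul2l; first by rewrite lee_fin.
  by apply: poweR_half_le le; rewrite QE lee_fin; lra.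
split.
  move=> t1 p p1 wAp q; have [vA le] := in_Ad_powR_ge1 t1 p1 wC wAp.
  split => // f g fL2 fg.
  have q1 : 1 < q by rewrite /q; nra.
  have [_ [Q [Q1 QE _]]] := Ad_char_fin q1 vA.1 vA.2.
  have [_ [A [A1 AE _]]] := Ad_char_fin p1 wAp.1 wAp.2.
  have [_ [_ /(_ f g fL2 fg) bound]] := tHaar_estimate_Ad m n ww q1 vA QE C0 hC.
  move=> bound_q bound_p.
  have bq : (L2norm g <= bound_q)%E.
    rewrite /bound_q CE QE !poweR_EFin -!EFinM.
    by rewrite -[X in X%:E]mulrA.
  have qp : t <= 1 -> (bound_q <= bound_p)%E.
    move=> t_le1; apply: lee_wpmul2r; first exact: N0.
    rewrite CE QE AE !poweR_EFin -!EFinM lee_fin -[leLHS]mulrA -[leRHS]mulrA ler_wpM2l//.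
    have QA : Q <= C * A `^ (2 * t).
      by move: le; rewrite CE AE QE poweR_EFin -EFinM lee_fin.
    have A2 : A `^ (2 * t) <= A ^+ 2.
      by rewrite -powR_mulrn; [apply: ler_powR => //; lra|lra].
    have CA := ler_wpM2l (ltW C0) A2.
    apply: (powR_half_mul_le (ltW C0)); rewrite ?mulr_ge0 ?(ltW C0)//; try lra.
    have h := ler_wpM2l (ltW C0) (le_trans QA CA).
    by rewrite exprMn expr2 -mulrA.
  split => //; split => //.
  have [t_le1|t_gt1] := leP t 1; first exact: le_trans bq (qp t_le1).
  (* Here the power A^t is too large; instead the packing constant is taken
     from the C^d_{2t} condition. *)
  have s2 : 2 <= 2 * t by lra.
  have C1 := (carleson_Cd (0, 0) 0 s2 ww vi hC).1.
  have := (tHaar_estimate m n ww vi C0 C1 hC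
    (fun J N => (carleson_Cd J N s2 ww vi hC).2)).2 f g fL2 fg.
  move=> /le_trans; apply; apply: lee_wpmul2r; first exact: N0.
  rewrite CE AE -!EFinM lee_fin -[leRHS]mulrA ler_wpM2l//.
  apply: (powR_half_mul_le (ltW C0) (ltW C0)); first by rewrite mulr_ge0 ?(ltW C0)//; lra.
  by rewrite -expr2 exprMn ler_peMr ?sqr_ge0// exprn_ege1.
move=> t0; have s0 : 2 * t < 0 by lra.
have [vA le] := in_Ad_powR_lt0 s0 wC; split => // f g fL2 fg.
have q1 : 1 < 1 - 2 * t by lra.
have [_ [Q [Q1 QE _]]] := Ad_char_fin q1 vA.1 vA.2.
have [_ [_ /(_ f g fL2 fg)]] := tHaar_estimate_Ad m n ww q1 vA QE C0 hC.
move=> /le_trans; apply; apply: lee_wpmul2r; first exact: N0.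
rewrite CE -EFinM lee_fin ler_wpM2l//.
have QC : Q <= C by rewrite -lee_fin -QE -CE.
apply: (powR_half_mul_le (ltW C0)) => //; first by lra.
  exact: ltW.
by rewrite expr2 ler_wpM2l ?(ltW C0).
Qed.
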